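(* Let $q$ be a prime power, let $1\le k<n$ be integers, and let $E$ be the set of all $k\times n$ unimodular matrices over $\mathbb{F}_q[x]$. Then the natural density $D(E)$ of $E$ in $M_{k\times n}(\mathbb{F}_q[x])$ exists and $$D(E)=\prod_{j=n-k+1}^{n}\prod_{f}\Bigl(1-\frac{1}{q^{j\deg(f)}}\Bigr)=\prod_{j=n-k+1}^{n}\prod_{m=1}^{\infty}\Bigl(1-\frac{1}{q^{jm}}\Bigr)^{\varphi_m}=\prod_{j=n-k+1}^{n}\zeta_q(j)^{-1},$$ where $f$ runs over all monic irreducible polynomials in $\mathbb{F}_q[x]$ and $\varphi_m$ is the number of monic irreducible polynomials of degree $m$ in $\mathbb{F}_q[x]$.
   Context: $\mathbb{F}_q$ is the finite field with $q$ elements, and $\mathbb{F}_q[x]$ is its polynomial ring. $M_{k\times n}(R)$ denotes the set of $k\times n$ matrices over a ring $R$. Unimodular: a matrix $A\in M_{k\times n}(\mathbb{F}_q[x])$ is unimodular if it can be extended, by adjoining $n-k$ further rows, to an $n\times n$ matrix invertible over $\mathbb{F}_q[x]$. Enumeration of $\mathbb{F}_q[x]$: fix an identification (bijection) of $\{0,1,\dots,q-1\}$ with $\mathbb{F}_q$ in which the integer $0$ corresponds to $0\in\mathbb{F}_q$. For an integer $m\ge 0$ with base-$q$ expansion $m=\sum_{i\ge0}a_iq^i$, $a_i\in\{0,\dots,q-1\}$, $a_i=0$ for all large $i$, put $f_m(x)=\sum_{i\ge0}a_ix^i\in\mathbb{F}_q[x]$, where each $a_i$ is read as an element of $\mathbb{F}_q$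 via the identification. This gives a bijection $m\mapsto f_m$ from the nonnegative integers to $\mathbb{F}_q[x]$. Natural density: let $\mathcal{M}=M_{k\times n}(\mathbb{F}_q[x])$, and let $\mathcal{M}_N$ be the set of matrices in $\mathcal{M}$ all of whose entries lie in $\{f_0,f_1,\dots,f_N\}$. For $S\subseteq\mathcal{M}$, the natural density is $D(S)=\lim_{N\to\infty}|S\cap\mathcal{M}_N|/|\mathcal{M}_N|$, if the limit exists. $q$-zeta function: $\zeta_q(j)=\prod_f\bigl(1-q^{-j\deg(f)}\bigr)^{-1}=\prod_{m=1}^\infty\bigl(1-q^{-jm}\bigr)^{-\varphi_m}$, where $f$ runs over all monic irreducible polynomials in $\mathbb{F}_q[x]$ (the constant $1$ is not counted as irreducible). *)

(* Defs.v *)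
From HB Require Import structures.
From mathcomp Require Import all_boot all_order all_algebra finmap.
From mathcomp Require Import all_classical all_reals all_analysis.
From mathcomp.analysis.showcase Require Import summability.

Set Implicit Arguments.
Unset Strict Implicit.
Unset Printing Implicit Defensive.

Import Order.TTheory GRing.Theory Num.Theory.
Import numFieldNormedType.Exports.

Local Open Scope classical_set_scope.
Local Open Scope ring_scope.

Definition unimodular (F : fieldType) (k n : nat) (le_kn : (k <= n)%N) :
    set 'M[{poly F}]_(k, n) :=
  [set A | exists B : 'M[{poly F}]_(n - k, n),
     castmx (subnKC le_kn, erefl n) (col_mx A B) \in unitmx].

Lemma card_finField_gt0 (F : finFieldType) : (0 < #|F|)%N.
Proof. by rewrite ltnW ?card_finNzRing_gt1. Qed.

Definition digit (F : finFieldType) (m i : nat) : 'I_#|F| :=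
  Ordinal (ltn_pmod (m %/ #|F| ^ i) (card_finField_gt0 F)).

(* The digits of m at ranks i > m all vanish, so for e mapping the digit 0 to
   0 the truncation at rank m loses nothing. *)
Definition poly_of_nat (F : finFieldType) (e : 'I_#|F| -> F) (m : nat) :
    {poly F} :=
  \poly_(i < m.+1) e (digit F m i).

Definition box (F : finFieldType) (e : 'I_#|F| -> F) (k n N : nat) :
    set 'M[{poly F}]_(k, n) :=
  [set A | forall i j, exists2 m, (m <= N)%N & A i j = poly_of_nat e m].

(* [fset_set] returns the empty set on infinite sets; here it is only applied
   to subsets of a box, which is finite. *)
Definition box_ratio (R : realType) (F : finFieldType) (e : 'I_#|F| -> F)
    (k n : nat) (S : set 'M[{poly F}]_(k, n)) (N : nat) : R :=
  #|` fset_set (S `&` box e N) |%:R / #|` fset_set (@box F e k n N) |%:R.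

Definition has_natural_density (R : realType) (F : finFieldType)
    (e : 'I_#|F| -> F) (k n : nat) (S : set 'M[{poly F}]_(k, n)) (d : R) :
    Prop :=
  (fun N => box_ratio R e S N) @ \oo --> d.

Definition monic_irreducible (F : fieldType) : set {poly F} :=
  [set f | f \is monic /\ irreducible_poly f].

Definition polydeg (F : fieldType) (f : {poly F}) : nat := (size f).-1.

Definition num_monic_irreducible (F : finFieldType) (m : nat) : nat :=
  #|` fset_set [set f | monic_irreducible f /\ @polydeg F f = m] |.

(* Products over an infinite index set are unordered: limits along the finite
   index sets ordered by inclusion. *)
Definition partial_prod (R : realType) (T : choiceType) (D : set T)
    (x : T -> R) (J : {fset T}) : R :=
  \prod_(i <- J | i \in D) x i.

Definition euler_partial (R : realType) (F : finFieldType) (j : nat) :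
    {fset {poly F}} -> R :=
  partial_prod (@monic_irreducible F)
    (fun f => 1 - (#|F|%:R ^+ (j * polydeg f))^-1).

Definition euler_product (R : realType) (F : finFieldType) (j : nat) : R :=
  lim (@euler_partial R F j @ totally).

Definition degree_partial (R : realType) (F : finFieldType) (j M : nat) : R :=
  \prod_(1 <= m < M.+1)
    (1 - (#|F|%:R ^+ (j * m))^-1) ^+ num_monic_irreducible F m.

Definition degree_product (R : realType) (F : finFieldType) (j : nat) : R :=
  lim (@degree_partial R F j @ \oo).

Definition zeta_partial (R : realType) (F : finFieldType) (j : nat) :
    {fset {poly F}} -> R :=
  partial_prod (@monic_irreducible F)
    (fun f => (1 - (#|F|%:R ^+ (j * polydeg f))^-1)^-1).

Definition zetaq (R : realType) (F : finFieldType) (j : nat) : R :=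
  lim (@zeta_partial R F j @ totally).

(* Main.v *)
Require Import Defs.
From HB Require Import structures.
From mathcomp Require Import all_boot all_order all_algebra finmap.
From mathcomp Require Import perm qfpoly.
From mathcomp Require Import all_classical all_reals all_analysis.
From mathcomp.analysis.showcase Require Import summability.
From mathcomp Require Import zify ring lra.

(* A matrix extends to an invertible one iff it has full row rank modulo every
   monic irreducible f. By the Chinese remainder theorem and equidistribution of
   f_0, ..., f_N in residue classes, full rank modulo all f of degree at most T
   has density the product of the Euler factors of degree at most T. It remains
   to bound the matrices of the box that have full rank modulo these f but not
   modulo some f of larger degree.
   - If q ^ deg f <= N + 1, the proportion of bad matrices modulo f is
     O(q ^ (- 2 deg f)), because k < n; the sum over f is O(q ^ (- T)).
   - If q ^ deg f > N + 1, entries are determined by their residues modulo f.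
     Consider the first r such that the upper left (r + 1) x (r + 2) block B is
     bad modulo some such f. Either its leading square minor vanishes, or f is
     one of the at most r + 1 large prime factors of this minor. In both cases
     all but boundedly many values of one entry are excluded by the others,
     hence a proportion O(1 / N) in total. *)

Set Implicit Arguments.
Unset Strict Implicit.
Unset Printing Implicit Defensive.

Import Order.TTheory GRing.Theory Num.Theory.
Import numFieldNormedType.Exports.

Local Open Scope classical_set_scope.
Local Open Scope ring_scope.

(** * Unimodularity and rank modulo irreducible polynomials *)

(** Independence of the rows over the quotient by [f], phrased by divisibility so that it needs no
    quotient ring; [full_rank_modP] makes the link. *)
Definition full_rank_mod (F : fieldType) (f : {poly F}) (k n : nat)
    (A : 'M[{poly F}]_(k, n)) : Prop :=
  forall v : 'rV_k, (forall j, f %| (v *m A) 0 j) -> forall i, f %| v 0 i.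

Definition primitive_mx (F : fieldType) (k n : nat)
    (A : 'M[{poly F}]_(k, n)) : Prop :=
  forall f, monic_irreducible f -> full_rank_mod f A.

(** Descent on the size: either a divisor not associate to [p] is smaller, or [p] itself, made
    monic, is irreducible. The case [p = 0] is included, with witness 'X. *)
Lemma monic_irreducible_dvdp (F : fieldType) (p : {poly F}) :
  size p != 1 -> exists2 f, monic_irreducible f & f %| p.
Proof.
have [-> _|p0] := eqVneq p 0.
  exists ('X - 0%:P); last exact: dvdp0.
  by split; [exact: monicXsubC | exact: irredp_XsubC].
move: {2}(size p).+1 (ltnSn (size p)) => s; elim: s p p0 => // s IH p p0 ps p1.
have [[q [q1 qp qnp]]|H] :=
    pselect (exists q : {poly F}, [/\ size q != 1, q %| p & ~~ (q %= p)]).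
  have q0 : q != 0 by apply: contraNneq p0 => q0; rewrite q0 dvd0p in qp.
  have sq : (size q < s)%N.
    rewrite -ltnS; apply: leq_trans ps; rewrite ltnS ltn_neqAle dvdp_leq // andbT.
    by rewrite dvdp_size_eqp.
  have [f fi fq] := IH q q0 sq q1.
  by exists f => //; apply: dvdp_trans fq qp.
exists ((lead_coef p)^-1 *: p); last first.
  by rewrite dvdpZl ?invr_eq0 ?lead_coef_eq0.
split; first by rewrite monicE lead_coefZ mulVf ?lead_coef_eq0.
split; first by rewrite size_scale ?invr_eq0 ?lead_coef_eq0 // ltn_neqAle eq_sym p1 size_poly_gt0.
move=> q q1; rewrite dvdpZr ?invr_eq0 ?lead_coef_eq0 // => qp.
rewrite (eqp_trans (_ : q %= p)) //; last by rewrite eqp_sym eqp_scale ?invr_eq0 ?lead_coef_eq0.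
by apply/negP => qnp; apply: H; exists q; split => //; apply/negP.
Qed.

Lemma dvdp_mulmx (F : fieldType) (f : {poly F}) (m n p : nat)
    (A : 'M[{poly F}]_(m, n)) (B : 'M[{poly F}]_(n, p)) i :
  (forall j, f %| A i j) -> forall j, f %| (A *m B) i j.
Proof.
move=> fA j; rewrite mxE; elim/big_ind: _ => [|x y|l _]; first exact: dvdp0.
  exact: dvdp_add.
exact: dvdp_mulr.
Qed.

Lemma full_rank_mod_unitr (F : fieldType) (f : {poly F}) (k n : nat)
    (A : 'M[{poly F}]_(k, n)) (U : 'M[{poly F}]_n) :
  U \in unitmx -> full_rank_mod f (A *m U) <-> full_rank_mod f A.
Proof.
move=> uU; split=> H v fvA; apply: H.
  by rewrite mulmxA; apply: dvdp_mulmx.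
by rewrite -(mulmxK uU A) mulmxA; apply: dvdp_mulmx.
Qed.

Lemma primitive_mx_unitr (F : fieldType) (k n : nat)
    (A : 'M[{poly F}]_(k, n)) (U : 'M[{poly F}]_n) :
  U \in unitmx -> primitive_mx (A *m U) <-> primitive_mx A.
Proof.
by move=> uU; split=> H f /H; rewrite full_rank_mod_unitr.
Qed.

Lemma full_rank_mod_usubmx (F : fieldType) (f : {poly F}) (k1 k2 n : nat)
    (A : 'M[{poly F}]_(k1 + k2, n)) :
  full_rank_mod f A -> full_rank_mod f (usubmx A).
Proof.
move=> H v fvA i; have := H (row_mx v 0) _ (lshift k2 i).
rewrite row_mxEl; apply => j.
by rewrite -(vsubmxK A) mul_row_col mul0mx addr0.
Qed.

(* Among the rows [a *m U], U unimodular, a nonzero entry of least degree divides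
   all the others, hence is a unit by primitivity. *)
Lemma primitive_row_extend (F : fieldType) (n : nat) (a : 'rV[{poly F}]_n.+1) :
  primitive_mx a -> exists2 V, V \in unitmx & a = delta_mx 0 0 *m V.
Proof.
move=> pa.
(* A nonunit common divisor has an irreducible factor [f], modulo which the whole row vanishes. *)
have dvd_unit (b : 'rV_n.+1) (d : {poly F}) :
    primitive_mx b -> (forall j, d %| b 0 j) -> d \is a GRing.unit.
  move=> pb db; rewrite poly_unitE.
  have [d1|/monic_irreducible_dvdp[f fi fd]] := eqVneq (size d) 1; last first.
    have H : f %| (1%:M : 'M[{poly F}]_1) 0 0.
      by apply: (pb f fi 1%:M _ 0) => j; rewrite mul1mx (dvdp_trans fd).
    have [_ [f1 _]] := fi; move: H f1.
    by rewrite mxE eqxx dvdp1 => /eqP->.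
  rewrite unitfE; have /size_poly1P[c c0 ->] : size d == 1 by rewrite d1.
  by rewrite coefC.
pose P : pred nat := fun s => `[< exists U i, [/\ U \in unitmx, (a *m U) 0 i != 0 &
  size ((a *m U) 0 i) = s] >].
have exP : exists s, P s.
  have [a0|/eqP/rV0Pn[i ai]] := pselect (a = 0).
    suff : (0 : {poly F}) \is a GRing.unit by rewrite unitr0.
    by apply: (dvd_unit a) => // j; rewrite a0 mxE dvdp0.
  by exists (size (a 0 i)); apply/asboolP; exists 1%:M, i; rewrite mulmx1 unitmx1.
case: (ex_minnP exP) => s /asboolP[U [i [uU bi0 <-]]] smin {exP}.
have pb : primitive_mx (a *m U) by apply/primitive_mx_unitr.
move: bi0 smin pb; move defb: (a *m U) => b bi0 smin pb.
have dvdb j : b 0 i %| b 0 j.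
  have [<-|ij] := eqVneq i j; first exact: dvdpp.
  apply: contraT; rewrite /dvdp => r0.
  (* Column operation adding [c] times column [i] to column [j]. With minus the quotient as [c] it
     replaces entry [j] by its remainder, against the minimality of entry [i]. *)
  pose E (c : {poly F}) : 'M[{poly F}]_n.+1 := 1%:M + c *: delta_mx i j.
  have uE c : E c \in unitmx.
    apply: (proj1 (mulmx1_unit (_ : E c *m E (- c) = 1%:M))).
    rewrite /E mulmxDl mul1mx mulmxDr mulmx1 -scalemxAl -scalemxAr.
    by rewrite mul_delta_mx_0 1?eq_sym // !scaler0 addr0 scaleNr addrNK.
  suff /smin : P (size (b 0 j %% b 0 i)) by rewrite leqNgt ltn_modp bi0.
  apply/asboolP; exists (U *m E (- (b 0 j %/ b 0 i))), j.
  have -> : (a *m (U *m E (- (b 0 j %/ b 0 i)))) 0 j = b 0 j %% b 0 i.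
    rewrite mulmxA defb mulmxDr mulmx1 -scalemxAr !mxE (bigD1 i) //= big1 ?addr0.
      by rewrite mxE !eqxx mulr1 {1}(divp_eq (b 0 j) (b 0 i)) mulNr addrAC subrr add0r.
    by move=> l li; rewrite mxE (negPf li) mulr0.
  by split=> //; rewrite unitmx_mul uU uE.
have ubi : b 0 i \is a GRing.unit by exact: dvd_unit dvdb.
(* The rank one perturbation [1 + x y] of the identity has [b] as its row [i]. Since [1 + y x] is
   the unit [b 0 i], the Sherman-Morrison formula gives its inverse. *)
pose x : 'cV[{poly F}]_n.+1 := delta_mx i 0.
have [y yE] : exists y : 'rV[{poly F}]_n.+1, y = b - delta_mx 0 i by eexists.
have yx : y *m x = (b 0 i - 1)%:M.
  rewrite yE mulmxBl mul_delta_mx; apply/matrixP => r c; rewrite !ord1 !mxE.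
  by rewrite (bigD1 i) //= big1 ?addr0 ?mxE ?eqxx ?mulr1 // => l li; rewrite mxE (negPf li) mulr0.
have uW : 1%:M + x *m y \in unitmx.
  apply: (proj1 (mulmx1_unit (_ : _ *m (1%:M - (b 0 i)^-1 *: (x *m y)) = 1%:M))).
  rewrite mulmxDl mul1mx mulmxBr mulmx1 -scalemxAr.
  have -> : x *m y *m (x *m y) = (b 0 i - 1) *: (x *m y).
    by rewrite mulmxA -(mulmxA x) yx mul_mx_scalar -scalemxAl.
  rewrite scalerA mulrBr mulVr // mulr1 scalerBl scale1r.
  by rewrite opprB (addrC (x *m y)) !subrK.
have bE : b = delta_mx 0 i *m (1%:M + x *m y).
  rewrite mulmxDr mulmx1 mulmxA mul_delta_mx.
  have -> : delta_mx 0 0 = 1%:M :> 'M[{poly F}]_1.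
    by apply/matrixP => r c; rewrite !ord1 !mxE.
  by rewrite mul1mx yE addrC subrK.
(* The transposition moves row [i] to the top, and [invmx U] undoes the column operations. *)
exists (tperm_mx 0 i *m (1%:M + x *m y) *m invmx U).
  by rewrite !unitmx_mul unitmx_perm uW unitmx_inv uU.
rewrite !mulmxA -[tperm_mx 0 i]mulmx1 -[a in LHS](mulmxK uU) defb {1}bE.
congr (_ *m _ *m _); apply/rowP => l; rewrite mulmx1 -rowE mxE.
by rewrite /tperm_mx /perm_mx !mxE /= tpermL eq_sym.
Qed.

(** Induction on the rows: column operations turn the first row into a unit vector, and the lower
    right block that remains is again primitive. *)
Lemma primitive_mx_pid (F : fieldType) (k n : nat) (A : 'M[{poly F}]_(k, n)) :
  (k <= n)%N -> primitive_mx A -> exists2 V, V \in unitmx & A = pid_mx k *m V.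
Proof.
elim: k n A => [|k IH] n A kn pA.
  by exists 1%:M; [exact: unitmx1 | apply/matrixP => -[]].
case: n kn A pA => // n kn; rewrite -[k.+1]/(1 + k)%N => A pA.
have [|V0 uV0 defa] := @primitive_row_extend F n (usubmx A).
  by move=> f /pA; exact: full_rank_mod_usubmx.
pose A1 : 'M[{poly F}]_(1 + k, 1 + n) := A *m invmx V0.
have pA1 : primitive_mx A1 by apply/primitive_mx_unitr; rewrite ?unitmx_inv.
have [c [A2 defA1]] : exists c A2, A1 = block_mx 1%:M 0 c A2.
  exists (dlsubmx A1), (drsubmx A1).
  rewrite -[LHS]submxK; have u1 : usubmx A1 = delta_mx 0 0.
    by rewrite /A1 -mul_usub_mx defa mulmxK.
  congr block_mx; rewrite /ulsubmx /ursubmx u1; apply/matrixP => i j.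
    by rewrite !ord1 !mxE.
  by rewrite !mxE andbF.
have [|V1 uV1 defA2] := IH n A2 kn.
  move=> f fi v fv i.
  (* A relation [v] modulo [f] between the rows of [A2] lifts to [A1]: the coefficient of the first
     row is chosen to cancel the column [c]. *)
  have := pA1 f fi (row_mx (- (v *m c)) v) _ (rshift 1 i).
  rewrite row_mxEr; apply => j.
  rewrite defA1 mul_row_block mulmx1 mulmx0 add0r addNr.
  by case: (split_ordP j) => l ->; rewrite ?row_mxEl ?row_mxEr // mxE dvdp0.
exists (block_mx 1%:M 0 (pid_mx k *m c) V1 *m V0).
  by rewrite unitmx_mul uV0 andbT unitmxE (@det_lblock _ 1 n) det1 mul1r -unitmxE.
rewrite mulmxA -[A in LHS](mulmxKV uV0) -/A1 defA1; congr (_ *m _).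
have -> : pid_mx k.+1 = block_mx 1%:M 0 0 (pid_mx k) :> 'M[{poly F}]_(1 + k, 1 + n).
  apply/matrixP => i j; rewrite !mxE; case: (split_ordP i) => i' ->;
  rewrite !mxE; case: (split_ordP j) => j' ->; rewrite !mxE ?ord1 //=.
rewrite (@mulmx_block _ 1 k 1 n 1 n) !mulmx0 !mul0mx !mulmx1 !addr0 !add0r -defA2 mulmxA.
by rewrite pid_mx_id // pid_mx_1 mul1mx.
Qed.

(** The rows of an invertible matrix are independent modulo every [f], hence so are the first [k].
    Conversely, if [A = pid_mx k *m V], the last rows of [V] complete [A]. *)
Lemma unimodularP (F : fieldType) (k n : nat) (le_kn : (k <= n)%N)
    (A : 'M[{poly F}]_(k, n)) :
  unimodular le_kn A <-> primitive_mx A.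
Proof.
(* Generalizing [n - k] lets [n] be replaced by [k + m], and the cast disappears. *)
rewrite /unimodular /=; move: (n - k)%N (subnKC le_kn) => m E.
case: n / E le_kn A => le_kn A; rewrite /castmx /=; split.
  move=> [B uB] f fi.
  have := @full_rank_mod_usubmx F f k m _ (col_mx A B); rewrite col_mxKu; apply.
  rewrite -[col_mx A B]mul1mx; apply/full_rank_mod_unitr => // v.
  by rewrite mulmx1.
move=> /(primitive_mx_pid le_kn)[V uV ->]; exists (dsubmx V).
suff <- : usubmx V = pid_mx k *m V by rewrite vsubmxK.
by rewrite pid_mx_row -{2}(vsubmxK V) mul_row_col mul1mx mul0mx addr0.
Qed.

(** * Equidistribution of the enumeration in residue classes *)

Section PolyOfNat.

Variables (F : finFieldType) (e : 'I_#|F| -> F).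
Hypotheses (e_bij : bijective e).
Hypothesis (e0 : forall i : 'I_#|F|, nat_of_ord i = 0%N -> e i = 0).

Lemma coef_poly_of_nat m i : (poly_of_nat e m)`_i = e (digit F m i).
Proof.
rewrite coef_poly; case: ltnP => // mi; rewrite e0 //= divn_small ?mod0n //.
by apply: leq_trans (ltn_expl i (card_finNzRing_gt1 F)); rewrite leqW.
Qed.

Lemma poly_of_nat_inj : injective (poly_of_nat e).
Proof.
have q1 := card_finNzRing_gt1 F.
move=> m m' mm'; have {mm'} : forall i, m %/ #|F| ^ i = m' %/ #|F| ^ i %[mod #|F|].
  move=> i; have := congr1 (fun p : {poly F} => p`_i) mm'.
  by rewrite !coef_poly_of_nat => /(bij_inj e_bij)/(congr1 val).
(* Induction on [m + m']: the last digits agree, and the quotients by [#|F|] have equal digits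
   again. *)
move: {2}(m + m').+1 (ltnSn (m + m')) => b.
elim: b m m' => // b IH m m' mb mm'.
have [/eqP|m0] := posnP (m + m'); first by rewrite addn_eq0 => /andP[/eqP-> /eqP->].
rewrite (divn_eq m #|F|) (divn_eq m' #|F|); congr (_ * _ + _)%N; last first.
  by have := mm' 0%N; rewrite expn0 !divn1.
apply: IH => [|i]; last by have := mm' i.+1; rewrite expnS !divnMA.
have leq_q p : (p %/ #|F| <= p)%N by exact: leq_div.
have lt_q p : (0 < p)%N -> (p %/ #|F| < p)%N by move=> p0; exact: ltn_Pdiv.
have := leq_q m; have := leq_q m'; have := lt_q m; have := lt_q m'; lia.
Qed.

Lemma size_poly_of_nat m d : (m < #|F| ^ d)%N -> (size (poly_of_nat e m) <= d)%N.
Proof.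
move=> md; apply/leq_sizeP => i di; rewrite coef_poly_of_nat e0 //=.
rewrite divn_small ?mod0n //; apply: leq_trans md _.
by rewrite leq_exp2l // card_finNzRing_gt1.
Qed.

(** The base [#|F|] digits of [a] and [b] are juxtaposed without carry. This is the source of
    equidistribution. *)
Lemma poly_of_natD d a b : (b < #|F| ^ d)%N ->
  poly_of_nat e (a * #|F| ^ d + b) = poly_of_nat e a * 'X^d + poly_of_nat e b.
Proof.
move=> bd; apply/polyP => i; rewrite coefD coefMXn !coef_poly_of_nat.
have q0 := ltnW (card_finNzRing_gt1 F).
case: ltnP => di.
  rewrite add0r; congr e; apply: val_inj => /=.
  rewrite -(subnK (ltnW di)) expnD mulnA divnMDl ?expn_gt0 ?q0 //.
  by rewrite -(subnSK di) expnSr mulnA modnMDl.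
rewrite [e (digit F b i)]e0 ?addr0; last first.
  rewrite /= divn_small ?mod0n //; apply: leq_trans bd _.
  by rewrite leq_exp2l // card_finNzRing_gt1.
congr e; apply: val_inj => /=.
by rewrite -[in LHS](subnKC di) expnD divnMA divnMDl ?expn_gt0 ?q0 // (divn_small bd) addn0.
Qed.

End PolyOfNat.

(** The quotient is taken by [mk_monic g], which is [g] under these two hypotheses and a default
    polynomial otherwise. *)
Lemma in_qpoly_val (F : fieldType) (g p : {poly F}) :
  g \is monic -> (1 < size g)%N -> in_qpoly g p = p %% g :> {poly F}.
Proof.
by move=> mg sg; rewrite /= /mk_monic sg mg Pdiv.IdomainMonic.modpE.
Qed.

Lemma in_qpoly_eq (F : fieldType) (g p p' : {poly F}) :
  g \is monic -> (1 < size g)%N ->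
  (in_qpoly g p == in_qpoly g p') = (g %| p - p').
Proof.
move=> mg sg; transitivity (p %% g == p' %% g); first by rewrite -!in_qpoly_val.
by rewrite -subr_eq0 -modpN -modpD.
Qed.

Section Residues.

Variables (F : finFieldType) (e : 'I_#|F| -> F).
Hypotheses (e_bij : bijective e).
Hypothesis (e0 : forall i : 'I_#|F|, nat_of_ord i = 0%N -> e i = 0).
Variables (g : {poly F}).
Hypotheses (mg : g \is monic) (sg : (1 < size g)%N).

Let Q := #|{poly %/ g}|.

(** Within a block of [Q] consecutive indices the high digits agree, so two polynomials differ by
    one of degree less than that of [g]. *)
Lemma residue_unique a b b' : (b < Q)%N -> (b' < Q)%N ->
  in_qpoly g (poly_of_nat e (a * Q + b)) =
  in_qpoly g (poly_of_nat e (a * Q + b')) -> b = b'.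
Proof.
rewrite /Q card_monic_qpoly // => bQ bQ' /eqP.
rewrite in_qpoly_eq // !(poly_of_natD e0) // opprD addrACA subrr add0r => gb.
apply/(poly_of_nat_inj e_bij e0)/eqP; rewrite -subr_eq0.
apply: contraTT gb => nz; apply/negP => /(dvdp_leq nz); apply/negP.
rewrite -ltnNge -(prednK (ltnW sg)) ltnS; apply: leq_trans (size_polyD _ _) _.
by rewrite size_polyN geq_max !(size_poly_of_nat e0).
Qed.

Lemma residue_exists a (r : {poly %/ g}) :
  exists2 b, (b < Q)%N & in_qpoly g (poly_of_nat e (a * Q + b)) = r.
Proof.
pose h (b : 'I_Q) := in_qpoly g (poly_of_nat e (a * Q + b)).
have /inj_card_bij : injective h.
  by move=> b b' /residue_unique H; apply: val_inj; apply: H.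
rewrite card_ord leqnn => -[] // h' _ hK.
by exists (h' r) => //; exact: hK.
Qed.

(** Each complete block of [Q] indices meets the class [r] exactly once, and the last incomplete
    block at most once. *)
Lemma card_residue N (r : {poly %/ g}) :
  (N.+1 %/ Q <= #|[pred m : 'I_N.+1 | in_qpoly g (poly_of_nat e m) == r]|
   <= (N.+1 %/ Q).+1)%N.
Proof.
have Q0 : (0 < Q)%N by rewrite /Q card_monic_qpoly // expn_gt0 (ltnW (card_finNzRing_gt1 F)).
set D := [pred m | _]; apply/andP; split.
  have lt_m (a : 'I_(N.+1 %/ Q)) : exists m : 'I_N.+1, (m \in D) && (m %/ Q == a)%N.
    have [b bQ rb] := residue_exists a r.
    have mN : (a * Q + b < N.+1)%N.
      apply: leq_trans (leq_divM N.+1 Q); apply: leq_trans (_ : a.+1 * Q <= _)%N.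
        by rewrite mulSn addnC ltn_add2r.
      by rewrite leq_mul2r ltn_ord orbT.
    exists (Ordinal mN); rewrite inE /= rb eqxx /=.
    by rewrite divnMDl // (divn_small bQ) addn0.
  pose h a := xchoose (lt_m a).
  have hD a : h a \in D by have /andP[] := xchooseP (lt_m a).
  have ha a : (h a %/ Q = a)%N by have /andP[_ /eqP] := xchooseP (lt_m a).
  have h_inj : injective h by move=> a a' E; apply: val_inj; rewrite /= -(ha a) E ha.
  rewrite -[X in (X <= _)%N]card_ord -(card_codom h_inj).
  by apply: subset_leq_card; apply/fintype.subsetP => m /codomP[a ->]; exact: hD.
have ltd (m : 'I_N.+1) : (m %/ Q < (N.+1 %/ Q).+1)%N.
  by rewrite ltnS leq_div2r // ltnW.
pose h m := Ordinal (ltd m).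
have h_inj : {in D &, injective h}.
  move=> m m'; rewrite !inE => /eqP rm /eqP rm' /(congr1 val) /= E.
  apply: val_inj; rewrite /= (divn_eq m Q) (divn_eq m' Q) E; congr (_ + _)%N.
  apply: (@residue_unique (m' %/ Q)); rewrite ?ltn_mod //.
  by rewrite -{1}E -!divn_eq rm rm'.
by rewrite -(card_in_image h_inj) -[X in (_ <= X)%N]card_ord max_card.
Qed.

End Residues.

(** * Counting matrices: boxes, residue classes, full row rank over a finite field *)

Lemma card_mx_family (T : finType) (k n : nat) (D : 'I_k -> 'I_n -> pred T) :
  #|[pred M : 'M[T]_(k, n) | [forall i, forall j, D i j (M i j)]]| =
  (\prod_(i < k) \prod_(j < n) #|D i j|)%N.
Proof.
pose h (f : {ffun 'I_k * 'I_n -> T}) : 'M[T]_(k, n) := \matrix_(i, j) f (i, j).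
have h_bij : bijective h.
  exists (fun M : 'M[T]_(k, n) => [ffun ij => M ij.1 ij.2]) => [f|M].
    by apply/ffunP => -[i j]; rewrite ffunE mxE.
  by apply/matrixP => i j; rewrite mxE ffunE.
rewrite -(on_card_preimset (onW_bij _ h_bij)).
transitivity #|family (fun ij : 'I_k * 'I_n => D ij.1 ij.2)|.
  apply: eq_card => f; rewrite !inE; apply/forallP/familyP => [H [i j]|H i].
    by have /forallP/(_ j) := H i; rewrite mxE.
  by apply/forallP => j; rewrite mxE; exact: H (i, j).
rewrite card_family foldrE big_map big_enum /=.
by rewrite -(pair_bigA _ (fun i j => #|D i j|)).
Qed.

(** Counting matrices of indices keeps the cardinals within finite types. As the enumeration is
    injective, they are those of [box_ratio]; see [card_fset_set_box]. *)
Definition boxcard (F : finFieldType) (e : 'I_#|F| -> F) (k n : nat)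
    (S : 'M[{poly F}]_(k, n) -> Prop) (N : nat) : nat :=
  #|[pred M : 'M['I_N.+1]_(k, n) |
      `[< S (map_mx (fun m : 'I_N.+1 => poly_of_nat e m) M) >]]|.

Section BoxCard.

Variables (F : finFieldType) (e : 'I_#|F| -> F).
Hypotheses (e_bij : bijective e).
Hypothesis (e0 : forall i : 'I_#|F|, nat_of_ord i = 0%N -> e i = 0).
Variables (k n : nat).
Implicit Types S : 'M[{poly F}]_(k, n) -> Prop.

Lemma card_fset_set_box S N :
  #|` fset_set ([set A | S A] `&` box e N) | = boxcard e S N.
Proof.
pose f (M : 'M['I_N.+1]_(k, n)) := map_mx (fun m : 'I_N.+1 => poly_of_nat e m) M.
have f_inj : injective f.
  move=> M M' E; apply/matrixP => i j; apply: val_inj.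
  by apply: (poly_of_nat_inj e_bij e0); move/matrixP: E => /(_ i j); rewrite !mxE.
have -> : [set A | S A] `&` box e N = [set` [fset f M | M in [pred M | `[< S (f M) >]]]%fset].
  apply/seteqP; split => A /=.
    move=> [SA bA]; have bA' i j : exists m : 'I_N.+1, A i j == poly_of_nat e m.
      by have [m mN ->] := bA i j; rewrite -ltnS in mN; exists (Ordinal mN) => /=.
    pose M := \matrix_(i, j) xchoose (bA' i j).
    have AM : A = f M by apply/matrixP => i j; rewrite !mxE; exact/eqP/(xchooseP (bA' i j)).
    by apply/imfsetP; exists M => //=; apply/asboolP; move: SA; rewrite {1}AM.
  move=> /imfsetP[M /= /asboolP SM ->]; split=> // i j.
  by exists (M i j); rewrite ?mxE // -ltnS.
by rewrite set_fsetK card_imfset //= -cardE.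
Qed.

Lemma boxcardT N : boxcard e (fun A : 'M[{poly F}]_(k, n) => True) N = (N.+1 ^ (k * n))%N.
Proof.
rewrite -[X in (X ^ _)%N]card_ord -card_mx; apply: eq_card => M.
by rewrite !inE; apply/asboolP.
Qed.

Lemma box_ratioE (R : realType) (S : set 'M[{poly F}]_(k, n)) N :
  box_ratio R e S N = (boxcard e S N)%:R / (N.+1 ^ (k * n))%:R.
Proof.
rewrite /box_ratio -boxcardT -!card_fset_set_box.
by congr (_ / _%:R); congr (#|` fset_set _ |); apply/seteqP; split=> A //= -[].
Qed.

Lemma le_boxcard S S' N : (forall A, S A -> S' A) ->
  (boxcard e S N <= boxcard e S' N)%N.
Proof.
move=> SS'; apply: subset_leq_card; apply/fintype.subsetP => M.
by move=> /asboolP SM; apply/asboolP; exact: SS'.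
Qed.

Lemma boxcardU S S' N :
  (boxcard e (fun A => S A \/ S' A) N <= boxcard e S N + boxcard e S' N)%N.
Proof.
rewrite /boxcard -cardUI; apply: leq_trans (leq_addr _ _).
apply: subset_leq_card; apply/fintype.subsetP => M.
by move=> /asboolP[H|H]; apply/orP; [left|right]; exact/asboolP.
Qed.

Lemma boxcard_bigU (T : eqType) (s : seq T) (S : T -> 'M[{poly F}]_(k, n) -> Prop) N :
  (boxcard e (fun A => exists2 x, x \in s & S x A) N
     <= \sum_(x <- s) boxcard e (S x) N)%N.
Proof.
elim: s => [|x s IH].
  rewrite big_nil leqn0; apply/eqP/eq_card0 => M.
  by apply/asboolP => -[x]; rewrite in_nil.
rewrite big_cons; apply: leq_trans (leq_add (leqnn _) IH).
apply: leq_trans (boxcardU _ _ _); apply: le_boxcard => A [y].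
by rewrite inE => /orP[/eqP->|ys] Sy; [left|right; exists y].
Qed.

(** The box is partitioned by residue matrices; the entries of a matrix with a prescribed residue
    are chosen independently, and [card_residue] bounds each choice. *)
Lemma boxcard_periodic (g : {poly F}) S (S' : pred 'M[{poly %/ g}]_(k, n)) N :
  g \is monic -> (1 < size g)%N ->
  (forall A, S A <-> S' (map_mx (in_qpoly g) A)) ->
  (#|S'| * (N.+1 %/ #|{poly %/ g}|) ^ (k * n) <= boxcard e S N
    <= #|S'| * (N.+1 %/ #|{poly %/ g}|).+1 ^ (k * n))%N.
Proof.
move=> mg sg SS'.
pose r (m : 'I_N.+1) := in_qpoly g (poly_of_nat e m).
have -> : boxcard e S N =
    (\sum_(A in S') \prod_(i < k) \prod_(j < n) #|[pred m | r m == A i j]|)%N.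
  rewrite /boxcard -sum1_card (partition_big (map_mx r) S') /=; last first.
    by move=> M /asboolP/SS'; rewrite -map_mx_comp.
  apply: eq_bigr => A SA.
  rewrite -(card_mx_family (fun i j => [pred m | r m == A i j])) -sum1_card.
  apply: eq_bigl => M; rewrite !inE; apply/andP/forallP => [[_ /eqP <-] i|H].
    by apply/forallP => j; rewrite /= mxE.
  have MA : map_mx r M = A.
    by apply/matrixP => i j; rewrite mxE; apply/eqP; have /forallP/(_ j) := H i.
  rewrite MA eqxx; split=> //; apply/asboolP; apply: (proj2 (SS' _)).
  by rewrite -map_mx_comp [X in S' X]MA.
have E c : (#|S'| * c ^ (k * n) = \sum_(A in S') \prod_(i < k) \prod_(j < n) c)%N.
  by rewrite sum_nat_const; congr (_ * _)%N; rewrite prod_nat_const prod_nat_const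
    !card_ord mulnC expnM.
have cr := @card_residue F e e_bij e0 g mg sg N.
apply/andP; split; rewrite E; apply: leq_sum => A _;
  apply: leq_prod => i _; apply: leq_prod => j _;
  by have /andP[] := cr (A i j).
Qed.

End BoxCard.

(** Row by row: a new last row must avoid the span of the [k] previous independent rows, which has
    [#|K| ^ k] elements. *)
Lemma card_row_free (K : finFieldType) (k n : nat) : (k <= n)%N ->
  #|[pred A : 'M[K]_(k, n) | row_free A]| =
  (\prod_(i < k) (#|K| ^ n - #|K| ^ i))%N.
Proof.
elim: k => [_|k IH /ltnW kn].
  rewrite big_ord0 (@fintype.eq_card1 _ (0 : 'M[K]_(0, n))) // => A.
  by rewrite !inE /row_free flatmx0 mxrank0 !eqxx.
rewrite big_ord_recr /= -(IH kn) -sum_nat_const -[k.+1]addn1 -sum1_card.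
rewrite (partition_big (@usubmx K k 1 n) [pred A | row_free A]) /=; last first.
  move=> A; rewrite !inE => fA; apply: inj_row_free => v vA.
  have /eqP : row_mx v 0 *m A == 0.
    by rewrite -{1}(vsubmxK A) mul_row_col vA mul0mx addr0.
  rewrite -[RHS](mul0mx _ A) => /(row_free_inj fA)/eqP; rewrite row_mx_eq0.
  by case/andP => /eqP.
apply: eq_bigr => A fA.
have <- : #|~: [set (v *m A : 'rV[K]_n) | v in [set: 'rV[K]_k]]%SET| = (#|K| ^ n - #|K| ^ k)%N.
  rewrite cardsCs finset.setCK card_imset ?cardsT ?card_mx ?mul1n //.
  exact: row_free_inj.
rewrite -sum1_card (reindex (fun v : 'rV[K]_n => col_mx A v)) /=; last first.
  exists dsubmx => [v _|B]; first by rewrite col_mxKd.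
  by rewrite inE => /andP[_ /eqP <-]; rewrite vsubmxK.
apply: eq_bigl => v; rewrite !inE col_mxKu eqxx andbT.
apply/idP/negP => [fB /imsetP[u _ uA]|vA].
  have /eqP : row_mx u (- 1%:M) *m col_mx A v == 0.
    by rewrite mul_row_col -uA mulNmx mul1mx subrr.
  rewrite -[RHS](mul0mx _ (col_mx A v)) => /(row_free_inj fB)/eqP; rewrite row_mx_eq0.
  by rewrite oppr_eq0 => /andP[_ /eqP/matrixP/(_ 0 0)]; rewrite !mxE => /eqP; rewrite oner_eq0.
apply: inj_row_free => w; rewrite -[w]hsubmxK mul_row_col.
rewrite [rsubmx w]mx11_scalar; move: (rsubmx w 0 0) (lsubmx w) => c u.
rewrite mul_scalar_mx; have [->|c0] := eqVneq c 0.
  rewrite scale0r addr0 -[RHS](mul0mx _ A) => /(row_free_inj fA) ->.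
  by rewrite raddf0 row_mx0.
move=> uv; case: vA; apply/imsetP; exists (- c^-1 *: u); rewrite ?inE //.
rewrite -scalemxAl; move/eqP: uv; rewrite addr_eq0 => /eqP ->.
by rewrite scalerN scaleNr opprK scalerA mulVf // scale1r.
Qed.

(** * Density of matrices of full rank modulo a squarefree polynomial *)

Lemma map_in_qpoly_surj (F : fieldType) (f : {poly F}) (k n : nat)
    (A : 'M[{poly %/ f}]_(k, n)) :
  map_mx (in_qpoly f) (map_mx (@polyn F _) A) = A.
Proof.
apply/matrixP => i j; rewrite !mxE; apply: val_inj.
by apply: in_qpoly_small; exact: size_mk_monic.
Qed.

Lemma full_rank_modP (F : fieldType) (f : {poly F})
    (hI : monic_irreducible_poly f) (k n : nat) (A : 'M[{poly F}]_(k, n)) :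
  full_rank_mod f A <->
  row_free (map_mx (in_qpoly f : {poly F} -> {poly %/ f with hI}) A).
Proof.
have [[sf _] mf] := hI.
have dvdE p : (f %| p) = (in_qpoly f p == 0).
  by rewrite -[p in LHS]subr0 -in_qpoly_eq // rmorph0.
split=> [H|fA v fvA i].
  apply: inj_row_free => v; rewrite -[v](@map_in_qpoly_surj F f) -map_mxM => vA.
  apply/rowP => i; rewrite !mxE; apply/eqP; rewrite -dvdE.
  have := H (map_mx (@polyn F _) v) _ i; rewrite mxE; apply => j.
  by rewrite dvdE; move/matrixP: vA => /(_ 0 j); rewrite !mxE => ->.
have : map_mx (in_qpoly f : {poly F} -> {poly %/ f with hI}) v = 0.
  apply: (row_free_inj fA); rewrite mul0mx -map_mxM; apply/matrixP => r j.
  by rewrite !ord1 mxE [RHS]mxE; apply/eqP; rewrite -dvdE.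
by move/matrixP/(_ 0 i); rewrite !mxE => /eqP; rewrite -dvdE.
Qed.

(** Local density: the proportion, among all residue matrices modulo [g], of those that make up the
    [g]-periodic set [S]. It is multiplicative over coprime moduli. *)
Definition mod_density (R : realType) (F : finFieldType) (k n : nat)
    (g : {poly F}) (S : 'M[{poly F}]_(k, n) -> Prop) (d : R) : Prop :=
  exists S' : pred 'M[{poly %/ g}]_(k, n),
    (forall A, S A <-> S' (map_mx (in_qpoly g) A)) /\
    #|S'|%:R = d * #|{poly %/ g}|%:R ^+ (k * n).

Definition euler_factor (R : realType) (F : finFieldType) (f : {poly F})
    (j : nat) : R := 1 - (#|F|%:R ^+ (j * polydeg f))^-1.

Lemma mod_density_full_rank (R : realType) (F : finFieldType) (f : {poly F})
    (k n : nat) : monic_irreducible f -> (k <= n)%N ->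
  mod_density f (@full_rank_mod F f k n)
    (\prod_(n - k + 1 <= j < n.+1) euler_factor R f j).
Proof.
move=> [mf iF] kn; have hI : monic_irreducible_poly f by split.
have [[sf _] _] := hI.
exists (fun A : 'M[{poly %/ f}]_(k, n) => row_free (A : 'M[{poly %/ f with hI}]_(k, n))).
split; first by move=> A; exact: (full_rank_modP hI).
rewrite (card_row_free {poly %/ f with hI} kn) (card_qfpoly hI).
rewrite /euler_factor -/(polydeg f).
set Q := (#|F| ^ polydeg f)%N.
have Q0 : (0 < Q)%N by rewrite expn_gt0 (ltnW (card_finNzRing_gt1 F)).
(* Substitution [j = n - i]: the factor [Q ^ n - Q ^ i] of [card_row_free], divided by [Q ^ n], is
   [1 - Q ^ (i - n)]. *)
have -> : \prod_(n - k + 1 <= j < n.+1) (1 - (#|F|%:R ^+ (j * polydeg f))^-1) =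
    \prod_(i < k) (1 - (Q%:R ^+ (n - i))^-1) :> R.
  rewrite -{1}[(n - k + 1)%N]add0n big_addn big_nat_rev /= add0n.
  rewrite (_ : n.+1 - (n - k + 1) = k)%N; last by lia.
  rewrite big_mkord; apply: eq_bigr => i _; congr (1 - _^-1).
  rewrite natrX -exprM mulnC; congr (_ ^+ (_ * _)).
  by have := ltn_ord i; lia.
move: Q Q0 => Q Q0; rewrite natr_prod mulnC exprM -[k in _ ^+ k]card_ord -prodr_const -big_split /=.
apply: eq_bigr => i _.
have iN : (i <= n)%N by apply: leq_trans (ltnW (ltn_ord i)) kn.
rewrite natrB ?leq_pexp2l // !natrX mulrBl mul1r; congr (_ - _).
rewrite -{2}(subnK iN) exprD mulKf //.
by rewrite expf_neq0 // pnatr_eq0 -lt0n.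
Qed.

(** Chinese remainder theorem: [red] is injective by coprimality, hence bijective by cardinality,
    and the two conditions become independent. *)
Lemma mod_densityI (R : realType) (F : finFieldType) (k n : nat)
    (g h : {poly F}) (S T : 'M[{poly F}]_(k, n) -> Prop) (c d : R) :
  g \is monic -> h \is monic -> (1 < size g)%N -> (1 < size h)%N ->
  coprimep g h ->
  mod_density g S c -> mod_density h T d ->
  mod_density (g * h) (fun A => S A /\ T A) (c * d).
Proof.
move=> mg mh sg sh cgh [S' [SS' cS]] [T' [TT' cT]].
have mgh : g * h \is monic by rewrite monicMl.
have sgh : size (g * h) = ((size g).-1 + (size h).-1).+1%N.
  by rewrite size_monicM ?monic_neq0 //; lia.
have s1 : (1 < size (g * h)%R)%N by rewrite sgh; lia.
pose red (A : 'M[{poly %/ (g * h)}]_(k, n)) :=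
  (map_mx (in_qpoly g) (map_mx (@polyn F _) A),
   map_mx (in_qpoly h) (map_mx (@polyn F _) A)).
have redE A : red (map_mx (in_qpoly (g * h)) A) = (map_mx (in_qpoly g) A, map_mx (in_qpoly h) A).
  congr (_, _); apply/matrixP => i j; rewrite !mxE; apply/eqP;
  rewrite in_qpoly_eq // in_qpoly_val // -dvdpNr opprB
    {1}(divp_eq (A i j) (g * h)) addrK dvdp_mull //.
    by rewrite dvdp_mulr.
  by rewrite dvdp_mull.
have cgh' : #|{poly %/ (g * h)}| = (#|{poly %/ g}| * #|{poly %/ h}|)%N.
  by rewrite !card_monic_qpoly // sgh /= expnD.
have red_bij : bijective red.
  apply: inj_card_bij; last first.
    by rewrite card_prod !card_mx cgh' expnMn.
  move=> A B; rewrite -[A]map_in_qpoly_surj -[B]map_in_qpoly_surj !redE => -[Eg Eh].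
  apply/matrixP => i j; rewrite !mxE; apply/eqP; rewrite in_qpoly_eq //.
  rewrite Gauss_dvdp // -!in_qpoly_eq //.
  move/matrixP: Eg => /(_ i j); move/matrixP: Eh => /(_ i j); rewrite !mxE => -> ->.
  by rewrite !eqxx.
exists (fun A => S' (red A).1 && T' (red A).2); split.
  move=> A; rewrite redE /=; split=> [[/SS' -> /TT' ->]//|/andP[/SS' ? /TT' ?]//].
have -> : #|(fun A => S' (red A).1 && T' (red A).2)| = #|[predX S' & T']|.
  by rewrite -(on_card_preimset (onW_bij _ red_bij)); apply: eq_card => A; rewrite !inE.
rewrite cardX natrM cS cT cgh' natrM exprMn.
by rewrite mulrACA.
Qed.

Lemma monic_irreducible_coprime (F : fieldType) (f g : {poly F}) :
  monic_irreducible f -> monic_irreducible g -> f != g -> coprimep f g.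
Proof.
move=> [mf iF] [mg ig] fg; rewrite irreducible_poly_coprime //.
apply: contra fg => fg; have [[sf _] [_ Hg]] := (iF, ig).
have := Hg f _ fg; rewrite neq_ltn sf orbT => /(_ isT).
by rewrite eqp_monic.
Qed.

Lemma coprimep_prod_irreducible (F : fieldType) (f : {poly F}) (s : seq {poly F}) :
  monic_irreducible f -> (forall g, g \in s -> monic_irreducible g) ->
  f \notin s -> coprimep f (\prod_(g <- s) g).
Proof.
move=> fi si fs; rewrite big_seq; elim/big_ind: _ => [|g h cg ch|g gs].
- exact: coprimep1.
- by rewrite coprimepMr cg.
- by apply: monic_irreducible_coprime => //; [exact: si|apply: contraNneq fs => ->].
Qed.

(** Iterated Chinese remainder theorem; nonemptiness of [s] gives the modulus positive degree. *)
Lemma mod_density_prod (R : realType) (F : finFieldType) (k n : nat)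
    (s : seq {poly F}) (S : {poly F} -> 'M[{poly F}]_(k, n) -> Prop)
    (d : {poly F} -> R) :
  s != [::] -> uniq s -> (forall f, f \in s -> monic_irreducible f) ->
  (forall f, f \in s -> mod_density f (S f) (d f)) ->
  [/\ (\prod_(f <- s) f) \is monic, (1 < size (\prod_(f <- s) f)%R)%N &
  mod_density (\prod_(f <- s) f) (fun A => forall f, f \in s -> S f A)
    (\prod_(f <- s) d f)].
Proof.
case: s => // f s _; elim: s f => [|g s IH] f.
  move=> _ /(_ f) fi /(_ f); rewrite !big_seq1 inE eqxx in fi * => /(_ isT) H.
  have [mf [sf _]] := fi isT; split=> //; case: H => S' [SS' cS]; exists S'; split=> // A.
  rewrite -SS'; split=> [/(_ f)|SA h]; first by apply; rewrite inE.
  by rewrite inE => /eqP->.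
rewrite [uniq _]/= => /andP[fs us] si sd.
have [||mP sP dP] := IH g us.
- by move=> h hs; apply: si; rewrite inE hs orbT.
- by move=> h hs; apply: sd; rewrite inE hs orbT.
have fi := si f (mem_head _ _); have [mf [sf _]] := fi.
rewrite !(big_cons _ _ f); move: mP sP dP; set P := \prod_(_ <- _) _ => mP sP dP.
have mfP : f * P \is monic by rewrite monicMl.
split=> //.
  by rewrite size_monicM ?monic_neq0 //; move: sP sf; set x := size P; set y := size f; lia.
have cP : coprimep f P.
  by apply: coprimep_prod_irreducible => // h hs; apply: si; rewrite inE hs orbT.
have [S' [SS' cS]] := mod_densityI mf mP sf sP cP (sd f (mem_head _ _)) dP.
exists S'; split=> // A; rewrite -SS'; split=> [H|[Hf Hs] h].
  by split=> [|h hs]; apply: H; rewrite inE ?eqxx // hs orbT.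
by rewrite inE => /orP[/eqP->|/Hs].
Qed.

Lemma prod_1B_ge (R : realType) (I : Type) (r : seq I) (x : I -> R) :
  (forall i, 0 <= x i <= 1) -> 1 - \sum_(i <- r) x i <= \prod_(i <- r) (1 - x i).
Proof.
(* The upper bound 1 on the product is what lets the induction absorb the cross term. *)
move=> x01; suff : 1 - \sum_(i <- r) x i <= \prod_(i <- r) (1 - x i) <= 1 by case/andP.
elim: r => [|i r /andP[IH P1]]; first by rewrite !big_nil subr0 lexx.
rewrite !big_cons; have /andP[x0 x1] := x01 i.
have P0 : 0 <= \prod_(j <- r) (1 - x j).
  by apply: prodr_ge0 => j _; rewrite subr_ge0; have /andP[] := x01 j.
by move: IH P1 P0; set a := \sum_(_ <- _) _; set b := \prod_(_ <- _) _; nra.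
Qed.

(** * Limits and uniform bounds for proportions in the box *)

Section BoxDensity.

Variables (R : realType) (F : finFieldType) (e : 'I_#|F| -> F).
Hypotheses (e_bij : bijective e).
Hypothesis (e0 : forall i : 'I_#|F|, nat_of_ord i = 0%N -> e i = 0).
Variables (k n : nat).
Implicit Types S : 'M[{poly F}]_(k, n) -> Prop.

Lemma cvg_divn_ratio (Q : nat) : (0 < Q)%N ->
  ((N.+1 %/ Q)%:R / N.+1%:R : R) @[N --> \oo] --> (Q%:R^-1 : R) /\
  ((N.+1 %/ Q).+1%:R / N.+1%:R : R) @[N --> \oo] --> (Q%:R^-1 : R).
Proof.
move=> Q0.
have h0 : (N.+1%:R^-1 : R) @[N --> \oo] --> (0 : R) by exact: cvg_harmonic.
have Q0' : 0 < Q%:R :> R by rewrite ltr0n.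
have lo N : (N.+1 %/ Q)%:R * Q%:R <= N.+1%:R :> R by rewrite -natrM ler_nat leq_divM.
have hi N : N.+1%:R <= (N.+1 %/ Q).+1%:R * Q%:R :> R.
  by rewrite -natrM ler_nat ltnW // ltn_ceil.
have aux N : (Q%:R^-1 - N.+1%:R^-1 : R) <= (N.+1 %/ Q)%:R / N.+1%:R <= (Q%:R^-1 : R).
  have N0 : 0 < N.+1%:R :> R by rewrite ltr0n.
  have hiN := hi N; rewrite -[(_ %/ _).+1]addn1 natrD in hiN.
  apply/andP; split; last by rewrite ler_pdivrMr // ler_pdivlMl // mulrC.
  rewrite -subr_ge0 (_ : _ - _ =
    (((N.+1 %/ Q)%:R + 1) * Q%:R - N.+1%:R) / (Q%:R * N.+1%:R)); last first.
    by field; rewrite !gt_eqF.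
  by rewrite mulr_ge0 ?subr_ge0 // invr_ge0 mulr_ge0 ?ltW.
have c1 : ((N.+1 %/ Q)%:R / N.+1%:R : R) @[N --> \oo] --> (Q%:R^-1 : R).
  apply: (@squeeze_cvgr _ _ _ _ (fun N => Q%:R^-1 - N.+1%:R^-1) (fun=> Q%:R^-1)).
  - by near=> N; exact: aux.
  - by rewrite -[X in _ --> X]subr0; apply: cvgB => //; exact: cvg_cst.
  - exact: cvg_cst.
split=> //.
rewrite (_ : (fun N => _) = (fun N => (N.+1 %/ Q)%:R / N.+1%:R + N.+1%:R^-1)).
  by rewrite -[X in _ --> X]addr0; exact: cvgD.
by apply/funext => N; rewrite -[(_ %/ _).+1]addn1 natrD mulrDl mul1r.
Unshelve. all: by end_near.
Qed.

(** Both bounds of [boxcard_periodic], divided by the size of the box, tend to [d]. *)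
Lemma boxcard_cvg (g : {poly F}) S (d : R) : g \is monic -> (1 < size g)%N ->
  mod_density g S d ->
  ((boxcard e S N)%:R / (N.+1 ^ (k * n))%:R : R) @[N --> \oo] --> d.
Proof.
move=> mg sg [S' [SS' cS]].
set Q := #|{poly %/ g}| in cS.
have Q0 : (0 < Q)%N by rewrite /Q card_monic_qpoly // expn_gt0 (ltnW (card_finNzRing_gt1 F)).
have [c1 c2] := cvg_divn_ratio Q0.
have -> : d = #|S'|%:R * Q%:R^-1 ^+ (k * n).
  by rewrite cS exprVn mulfK // expf_neq0 // pnatr_eq0 -lt0n.
have cX m (u : R ^nat) (l : R) : u N @[N --> \oo] --> l -> u N ^+ m @[N --> \oo] --> l ^+ m.
  exact: continuous_cvg (@exprn_continuous R m l).
have p1 := cvgM (cvg_cst (#|S'|%:R : R)) (cX (k * n)%N _ _ c1).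
have p2 := cvgM (cvg_cst (#|S'|%:R : R)) (cX (k * n)%N _ _ c2).
apply: (squeeze_cvgr _ (p1 _ _) (p2 _ _)); near=> N => /=.
have N0 : 0 < (N.+1 ^ (k * n))%:R :> R by rewrite ltr0n expn_gt0.
have /andP[lo hi] := boxcard_periodic e_bij e0 N mg sg SS'.
rewrite !exprMn !exprVn !mulrA -!natrX -!natrM !ler_pM2r ?invr_gt0 //.
by rewrite !ler_nat lo.
Unshelve. all: by end_near.
Qed.

(** A bound uniform in [g], as summation over irreducibles requires. When [Q <= N + 1], rounding up
    at most doubles [(N + 1) / Q] in each entry, whence [2 ^ (k * n)]. *)
Lemma boxcard_mod_le (g : {poly F}) S (d : R) N : g \is monic -> (1 < size g)%N ->
  (#|F| ^ polydeg g <= N.+1)%N -> mod_density g S d ->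
  (boxcard e (fun A => ~ S A) N)%:R <= (1 - d) * 2 ^+ (k * n) * (N.+1 ^ (k * n))%:R.
Proof.
move=> mg sg gN [S' [SS' cS]].
have cQ : #|{poly %/ g}| = (#|F| ^ polydeg g)%N by rewrite card_monic_qpoly.
set Q := #|{poly %/ g}| in cS cQ.
have Q0 : (0 < Q)%N by rewrite cQ expn_gt0 (ltnW (card_finNzRing_gt1 F)).
have Q0' : 0 < Q%:R :> R by rewrite ltr0n.
have SC A : ~ S A <-> [predC S'] (map_mx (in_qpoly g) A).
  by rewrite SS' /=; split=> /negP.
have /andP[_ hi] := boxcard_periodic e_bij e0 N mg sg SC.
apply: (@le_trans _ _ (#|[predC S']| * (N.+1 %/ Q).+1 ^ (k * n))%:R).
  by rewrite ler_nat.
have cC : #|[predC S']|%:R = (1 - d) * Q%:R ^+ (k * n) :> R.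
  rewrite mulrBl mul1r -cS; apply/eqP; rewrite -subr_eq opprK addrC -natrD.
  by rewrite cardC card_mx natrX.
rewrite natrM cC -!mulrA ler_wpM2l //.
  have : 0 <= #|[predC S']|%:R :> R by rewrite ler0n.
  by rewrite cC pmulr_lge0 // exprn_gt0.
rewrite !natrX -!exprMn lerXn2r ?nnegrE ?mulr_ge0 //.
rewrite -!natrM ler_nat; have := leq_divM N.+1 Q.
by rewrite -cQ in gN; rewrite mulSn; lia.
Qed.

(** One minus the product of the Euler factors is at most the sum of [k] terms [Q ^ (- j)], where
    [j >= n - k + 1 >= 2]. The exponent 2 makes the sum over [f] converge. *)
Lemma boxcard_not_full_rank_le (f : {poly F}) N : (0 < k)%N -> (k < n)%N ->
  monic_irreducible f -> (#|F| ^ polydeg f <= N.+1)%N ->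
  (boxcard e (fun A : 'M[{poly F}]_(k, n) => ~ full_rank_mod f A) N)%:R <=
   (k * 2 ^ (k * n))%:R * (#|F|%:R ^- (2 * polydeg f)) * (N.+1 ^ (k * n))%:R :> R.
Proof.
move=> k0 kn fi fN; have [mf [sf _]] := fi.
apply: le_trans (boxcard_mod_le mf sf fN (mod_density_full_rank R fi (ltnW kn))) _.
rewrite ler_wpM2r // natrM natrX mulrAC ler_wpM2r // lerBlDr -lerBlDl.
have q1 : 1 <= #|F|%:R :> R by rewrite ler1n (ltnW (card_finNzRing_gt1 F)).
have q0 m : 0 < #|F|%:R ^+ m :> R by rewrite exprn_gt0 // (lt_le_trans ltr01).
apply: le_trans (prod_1B_ge _ _); last first.
  by move=> j; rewrite invr_ge0 (ltW (q0 _)) invf_le1 // exprn_ege1.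
rewrite lerD2l lerN2.
have -> : k%:R * #|F|%:R ^- (2 * polydeg f) =
    \sum_(n - k + 1 <= j < n.+1) #|F|%:R ^- (2 * polydeg f) :> R.
  rewrite sumr_const_nat -[RHS]mulr_natl; congr (_%:R * _); lia.
rewrite big_seq [leRHS]big_seq; apply: ler_sum => j; rewrite mem_index_iota => /andP[j2 _].
rewrite lef_pV2 ?posrE // ler_weXn2l // leq_mul2r; apply/orP; right.
by lia.
Qed.

End BoxDensity.

(** * Irreducible polynomials of large degree *)

(** Entries indexed by natural numbers let corners of all sizes share them without casts between
    ordinals. *)
Definition upper_left (R : Type) (r t : nat) (a : nat -> nat -> R) : 'M[R]_(r, t) :=
  \matrix_(i, j) a i j.

Lemma irreducible_dvdpM (F : fieldType) (f p q : {poly F}) :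
  irreducible_poly f -> f %| p * q -> ~~ (f %| p) -> f %| q.
Proof.
move=> fi fpq fp; rewrite -(Gauss_dvdpr q (_ : coprimep f p)) //.
by rewrite irreducible_poly_coprime.
Qed.

Lemma upper_left_dvdp (F : fieldType) (f : {poly F}) (r t t' : nat)
    (a : nat -> nat -> {poly F}) (v : 'rV[{poly F}]_r) : (t' <= t)%N ->
  (forall j, f %| (v *m upper_left r t a) 0 j) ->
  forall j, f %| (v *m upper_left r t' a) 0 j.
Proof.
move=> tt fv j; have := fv (widen_ord tt j); rewrite !mxE.
by under eq_bigr do rewrite mxE; under [in X in _ -> X]eq_bigr do rewrite mxE.
Qed.

(** Modulo [f] the last row drops out of the relation, which is then one between [r] independent
    rows. *)
Lemma upper_left_full_rank0 (F : fieldType) (f : {poly F}) (r t : nat)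
    (a : nat -> nat -> {poly F}) (v : 'rV[{poly F}]_r.+1) :
  full_rank_mod f (upper_left r t a) ->
  (forall j, f %| (v *m upper_left r.+1 t a) 0 j) ->
  f %| v 0 ord_max -> forall i, f %| v 0 i.
Proof.
move=> fr fv fvr i.
have H : forall i : 'I_r, f %| (\row_i v 0 (widen_ord (leqnSn r) i)) 0 i.
  apply: fr => j; have := fv j; rewrite !mxE big_ord_recr /=.
  rewrite dvdp_addl; last by rewrite dvdp_mulr.
  by under eq_bigr do rewrite mxE; under [in X in _ -> X]eq_bigr do rewrite !mxE.
have [ir|ir] := ltnP i r; last first.
  by have -> : i = ord_max by apply: val_inj; have := ltn_ord i => /=; lia.
have := H (Ordinal ir); rewrite mxE.
by have -> : widen_ord (leqnSn r) (Ordinal ir) = i by apply: val_inj.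
Qed.

(** Multiplying a relation by the adjugate shows that [f] divides the determinant times each
    coefficient. *)
Lemma dvdp_det_upper_left (F : fieldType) (f : {poly F}) (r : nat)
    (a : nat -> nat -> {poly F}) : irreducible_poly f ->
  ~ full_rank_mod f (upper_left r.+1 r.+2 a) ->
  f %| \det (upper_left r.+1 r.+1 a).
Proof.
move=> fi; apply: contra_notT => fD v /(upper_left_dvdp (leqnSn r.+1)) fv i.
have fvD : f %| \det (upper_left r.+1 r.+1 a) * v 0 i.
  have -> : \det (upper_left r.+1 r.+1 a) * v 0 i =
      (v *m upper_left r.+1 r.+1 a *m \adj (upper_left r.+1 r.+1 a)) 0 i.
    by rewrite -mulmxA mul_mx_adj mul_mx_scalar mxE.
  exact: dvdp_mulmx.
exact: irreducible_dvdpM fvD fD.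
Qed.

(** When the rows above are independent modulo [f], a dependent last row is a combination of them
    fixed by its first [r + 1] entries. Its last entry is therefore determined modulo [f]. *)
Lemma dvdp_entry_upper_left (F : fieldType) (f : {poly F}) (r : nat)
    (a b : nat -> nat -> {poly F}) : irreducible_poly f ->
  (forall i j, (i, j) != (r, r.+1) -> a i j = b i j) ->
  full_rank_mod f (upper_left r r.+1 a) ->
  ~ full_rank_mod f (upper_left r.+1 r.+2 a) ->
  ~ full_rank_mod f (upper_left r.+1 r.+2 b) ->
  f %| a r r.+1 - b r r.+1.
Proof.
move=> fi ab fr /existsNP[v /not_implyP[fv /existsNP[i /negP vi]]].
move=> /existsNP[w /not_implyP[fw /existsNP[l /negP wl]]].
have abB : upper_left r.+1 r.+1 b = upper_left r.+1 r.+1 a.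
  apply/matrixP => x y; rewrite !mxE ab // xpair_eqE negb_and.
  by rewrite (ltn_eqF (ltn_ord y)) orbT.
have fvB := upper_left_dvdp (leqnSn r.+1) fv.
have fwB := upper_left_dvdp (leqnSn r.+1) fw.
rewrite abB in fwB.
have vr : ~~ (f %| v 0 ord_max).
  by apply: contra vi => fvr; apply: upper_left_full_rank0 fr fvB fvr i.
have wr : ~~ (f %| w 0 ord_max).
  by apply: contra wl => fwr; apply: upper_left_full_rank0 fr fwB fwr l.
(* Cross-multiplication cancels the last coefficient, so [u] vanishes modulo [f]; column [r + 1]
   then compares the two entries. *)
pose u := w 0 ord_max *: v - v 0 ord_max *: w.
have fu : forall i, f %| u 0 i.
  apply: (upper_left_full_rank0 fr).
    move=> j; rewrite mulmxBl -!scalemxAl.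
    have -> (p q : {poly F}) (x y : 'rV[{poly F}]_r.+1) :
      (p *: x - q *: y) 0 j = p * x 0 j - q * y 0 j by rewrite !mxE.
    by rewrite dvdp_sub // dvdp_mull.
  by rewrite !mxE mulrC subrr dvdp0.
have : f %| v 0 ord_max * (w 0 ord_max * (a r r.+1 - b r r.+1)).
  have -> : v 0 ord_max * (w 0 ord_max * (a r r.+1 - b r r.+1)) =
     w 0 ord_max * (v *m upper_left r.+1 r.+2 a) 0 ord_max
     - v 0 ord_max * (w *m upper_left r.+1 r.+2 b) 0 ord_max
     - \sum_(i < r) u 0 (widen_ord (leqnSn r) i) * a i r.+1.
    rewrite ![(_ *m _) 0 _]mxE !big_ord_recr /= !mxE /=.
    under eq_bigr do rewrite mxE /=.
    under [in X in _ - X - _]eq_bigr => x _ do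
      rewrite mxE /= -ab ?xpair_eqE ?(ltn_eqF (ltn_ord x)) //.
    under [X in _ = _ - X]eq_bigr do rewrite !mxE mulrBl -!mulrA.
    rewrite sumrB -!mulr_sumr; ring.
  rewrite !dvdp_sub ?dvdp_mull //.
  by elim/big_ind: _ => [|x y|x _]; [exact: dvdp0|exact: dvdp_add|exact: dvdp_mulr].
by move=> /(irreducible_dvdpM fi)/(_ vr)/(irreducible_dvdpM fi)/(_ wr).
Qed.

Lemma eq_cofactor_upper_left (R : comNzRingType) (r : nat) (a b : nat -> nat -> R) j :
  (forall i l, (i < r)%N -> a i l = b i l) ->
  cofactor (upper_left r.+1 r.+1 a) ord_max j =
  cofactor (upper_left r.+1 r.+1 b) ord_max j.
Proof.
move=> ab; rewrite /cofactor; congr (_ * \det _).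
by apply/matrixP => i l; rewrite !mxE lift_max; exact: ab.
Qed.

(* If all these cofactors vanished, every unit vector would lie in the row space
   mod f of a matrix with fewer rows than columns. *)
Lemma exists_cofactor_neq0 (F : fieldType) (f : {poly F}) (r : nat)
    (a : nat -> nat -> {poly F}) : monic_irreducible f ->
  full_rank_mod f (upper_left r r.+1 a) ->
  exists j, cofactor (upper_left r.+1 r.+1 a) ord_max j != 0.
Proof.
move=> [mf iF] fr; apply: contrapT => /forallNP c0.
have hI : monic_irreducible_poly f by split.
have fA := (full_rank_modP hI _).1 fr.
pose red := in_qpoly f : {poly F} -> {poly %/ f with hI}.
suff H (j : 'I_r.+1) : ((delta_mx 0 j : 'rV_r.+1) <= map_mx red (upper_left r r.+1 a))%MS.
  have : (1%:M <= map_mx red (upper_left r r.+1 a))%MS.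
    by apply/row_subP => j; rewrite row1; exact: H.
  by move/mxrankS; rewrite mxrank1 leqNgt ltnS rank_leq_row.
(* With the unit vector of index [j] as last row, the determinant is the cofactor of index [j],
   hence zero. The resulting relation modulo [f] puts this unit vector in the row space. *)
pose b i l : {poly F} := if (i < r)%N then a i l else (l == j :> nat)%:R.
have detb : \det (upper_left r.+1 r.+1 b) = 0.
  rewrite (expand_det_row _ ord_max) (bigD1 j) //= big1 => [|l lj].
    rewrite (@eq_cofactor_upper_left _ _ b a) => [|i l ir]; last by rewrite /b ir.
    by have /negP/negPn/eqP -> := c0 j; rewrite mulr0 addr0.
  by rewrite mxE /b ltnn [(_ == _)](negPf lj) mul0r.
have : \det (map_mx red (upper_left r.+1 r.+1 b)) == 0.
  by rewrite det_map_mx detb rmorph0.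
move=> /det0P[v v0 vb].
pose u : 'rV[{poly %/ f with hI}]_r := \row_i v 0 (widen_ord (leqnSn r) i).
have uv : u *m map_mx red (upper_left r r.+1 a) = - v 0 ord_max *: delta_mx 0 j.
  apply/rowP => l; move/rowP: vb => /(_ l); rewrite !mxE big_ord_recr /=.
  rewrite !mxE /b /= ltnn => /eqP; rewrite addr_eq0 => /eqP E.
  rewrite mulNr.
  have -> : ((l == j)%:R : {poly %/ f with hI}) = red ((l == j :> nat)%:R).
    by rewrite /red rmorph_nat.
  rewrite -E; apply: eq_bigr => i _; rewrite !mxE /= ltn_ord //.
have [vm0|vm] := eqVneq (v 0 ord_max) 0.
  move: uv; rewrite vm0 oppr0 scale0r -[RHS](mul0mx _ (map_mx red (upper_left r r.+1 a))).
  move=> /(row_free_inj fA) u0; case/eqP: v0; apply/rowP => i; rewrite mxE.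
  have [ir|ir] := ltnP i r; last first.
    by have -> : i = ord_max by apply: val_inj; have := ltn_ord i => /=; lia.
  move/rowP: u0 => /(_ (Ordinal ir)); rewrite !mxE => <-.
  by congr (v 0 _); apply: val_inj.
apply/submxP; exists (- (v 0 ord_max)^-1 *: u).
by rewrite -scalemxAl uv scalerA mulrNN mulVf // scale1r.
Qed.

Lemma size_det_le (F : fieldType) (m s : nat) (A : 'M[{poly F}]_m) :
  (forall i j, size (A i j) <= s.+1)%N -> (size (\det A) <= (m * s).+1)%N.
Proof.
move=> As; apply: leq_trans (size_sum _ _ _) _; apply/bigmax_leqP => p _.
rewrite size_Msign; apply: leq_trans (size_poly_prod_leq _ _) _.
rewrite leq_subLR card_ord addnS ltnS -mulnS.
apply: (@leq_trans (\sum_(i < m) s.+1)); first exact: leq_sum.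
by rewrite sum_nat_const card_ord.
Qed.

Lemma dvdp_prod_irreducible (F : fieldType) (D : {poly F}) (t : seq {poly F}) :
  uniq t -> (forall f, f \in t -> monic_irreducible f) ->
  (forall f, f \in t -> f %| D) -> \prod_(f <- t) f %| D.
Proof.
elim: t => [|f t IH] /=; first by rewrite big_nil dvd1p.
move=> /andP[ft ut] ti tD; rewrite big_cons Gauss_dvdp; last first.
  apply: coprimep_prod_irreducible => // [|g gt]; apply: ti; rewrite inE ?eqxx //.
  by rewrite gt orbT.
rewrite tD ?mem_head //=; apply: IH => // g gt; [apply: ti|apply: tD];
by rewrite inE gt orbT.
Qed.

Lemma size_prod_irreducible (F : fieldType) (s : nat) (t : seq {poly F}) :
  (forall f, f \in t -> monic_irreducible f /\ (s < size f)%N) ->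
  (size t * s < size (\prod_(f <- t) f)%R)%N /\ \prod_(f <- t) f \is monic.
Proof.
elim: t => [|f t IH] ti; first by rewrite big_nil size_poly1 monic1.
have [|st mt] := IH; first by move=> g gt; apply: ti; rewrite inE gt orbT.
have [[mf _] sf] := ti f (mem_head _ _).
rewrite big_cons; split; last by rewrite monicMl.
rewrite size_monicM ?monic_neq0 //= mulSn.
by move: st sf; set P := \prod_(_ <- _) _; set x := size P; set y := size f; lia.
Qed.

(** The product of the [f] in [t] divides the determinant, so comparing degrees gives
    [size t * (s + 1) <= m * s]. *)
Lemma count_large_irreducible_divisors (F : fieldType) (m s : nat)
    (A : 'M[{poly F}]_m) (t : seq {poly F}) :
  (forall i j, size (A i j) <= s.+1)%N -> \det A != 0 -> uniq t ->
  (forall f, f \in t -> [/\ monic_irreducible f, (s.+1 < size f)%N & f %| \det A]) ->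
  (size t <= m)%N.
Proof.
move=> As D0 ut tP.
have [lt_t _] := @size_prod_irreducible F s.+1 t
  (fun f ft => let: And3 a b _ := tP f ft in conj a b).
have := dvdp_leq D0 (dvdp_prod_irreducible ut
  (fun f ft => let: And3 a _ _ := tP f ft in a)
  (fun f ft => let: And3 _ _ a := tP f ft in a)).
have := size_det_le As; move: lt_t; set P := \prod_(_ <- _) _ => h1 h2 h3.
have : (size t * s.+1 < (m * s).+1)%N by apply: leq_trans h1 (leq_trans h3 h2).
by nia.
Qed.

Section MatrixUpdate.

Variables (X : finType) (k n : nat).
Implicit Types (M : 'M[X]_(k, n)) (p : 'I_k * 'I_n).

Definition mx_update M p (x : X) : 'M[X]_(k, n) :=
  \matrix_(i, j) if (i, j) == p then x else M i j.

Lemma mx_update_id M p x y : mx_update (mx_update M p x) p y = mx_update M p y.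
Proof. by apply/matrixP => i j; rewrite !mxE; case: eqP. Qed.

Lemma mx_update_self M p : mx_update M p (M p.1 p.2) = M.
Proof. by apply/matrixP => i j; rewrite mxE; case: eqP => // <-. Qed.

Lemma mx_update_at M p x : mx_update M p x p.1 p.2 = x.
Proof. by rewrite mxE -surjective_pairing eqxx. Qed.

(* Double counting: swapping [x] with the entry of [M] at position [pos M] is an
   involution of the set of pairs [(M, x)]. *)
Lemma card_determined_entry (pos : 'M[X]_(k, n) -> 'I_k * 'I_n)
    (S : pred 'M[X]_(k, n)) (c : nat) :
  (forall M x, pos (mx_update M (pos M) x) = pos M) ->
  (forall M, #|[pred x | S (mx_update M (pos M) x)]| <= c)%N ->
  (#|S| * #|X| <= c * #|{: 'M[X]_(k, n)}|)%N.
Proof.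
move=> posE Sc.
pose sw (u : 'M[X]_(k, n) * X) :=
  (mx_update u.1 (pos u.1) u.2, u.1 (pos u.1).1 (pos u.1).2).
have swK : involutive sw.
  by case=> M x; rewrite /sw /= posE mx_update_id mx_update_self mx_update_at.
have -> : (#|S| * #|X|)%N = #|[predX S & predT : pred X]| by rewrite cardX.
(* After the swap, membership in [S] restricts [x] to at most [c] values for each fixed [M]. *)
rewrite -(on_card_preimset (onW_bij _ (inv_bij swK))).
have -> : (c * #|{: 'M[X]_(k, n)}|)%N = (\sum_(M : 'M[X]_(k, n)) c)%N.
  by rewrite sum_nat_const mulnC.
rewrite -sum1_card (eq_bigl (fun u : 'M[X]_(k, n) * X =>
  predT u.1 && S (mx_update u.1 (pos u.1) u.2))); last first.
  by move=> u; rewrite !inE andbT.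
rewrite -(pair_big_dep predT (fun M x => S (mx_update M (pos M) x)) (fun _ _ => 1%N)) /=.
by apply: leq_sum => M _; rewrite sum1_card; exact: Sc.
Qed.

End MatrixUpdate.

(** * Counting matrices that fail modulo a large irreducible *)

Section LargePrimes.

Variables (F : finFieldType) (X : finType) (val_of : X -> {poly F}) (s : nat).
Hypothesis val_of_inj : injective val_of.
Hypothesis size_val : forall x, (size (val_of x) <= s.+1)%N.
Variables (k n : nat).
Hypothesis lt_kn : (k < n)%N.

(** The degree of [f] exceeds that of every value of [val_of], so entries congruent modulo [f] are
    equal. *)
Definition large_irreducible (f : {poly F}) := monic_irreducible f /\ (s.+1 < size f)%N.

Definition entry (M : 'M[X]_(k, n)) (i j : nat) : {poly F} :=
  if insub i is Some i' then
    if insub j is Some j' then val_of (M i' j') else 0 else 0.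

Lemma entryE M (i : 'I_k) (j : 'I_n) : entry M i j = val_of (M i j).
Proof. by rewrite /entry !valK. Qed.

Lemma entry_update M p x i j : (i, j) != (val p.1, val p.2) ->
  entry (mx_update M p x) i j = entry M i j.
Proof.
rewrite /entry; case: insubP => // i' _ <-; case: insubP => // j' _ <- np.
rewrite mxE; case: eqP => // E; case/eqP: np; by rewrite -E.
Qed.

Lemma size_entry M i j : (size (entry M i j) <= s.+1)%N.
Proof.
rewrite /entry; case: insubP => [i' _ _|_]; last by rewrite size_poly0.
by case: insubP => [j' _ _|_]; rewrite ?size_poly0.
Qed.

(** Corners are one column wider than high, and [k < n] leaves room for the one with [k] rows.
    Corner 0 is vacuously good, while corner [k] gives full rank of the whole matrix. *)
Definition corner_full_rank r M :=
  forall f, large_irreducible f -> full_rank_mod f (upper_left r r.+1 (entry M)).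

Lemma full_rank_of_corner M f :
  large_irreducible f -> corner_full_rank k M -> full_rank_mod f (map_mx val_of M).
Proof.
move=> lf /(_ f lf) H v fv; apply: H => j.
have jn : (j < n)%N by apply: leq_trans (ltn_ord j) lt_kn.
have := fv (Ordinal jn); rewrite !mxE.
under eq_bigr do rewrite mxE; under [in X in _ -> X]eq_bigr do rewrite mxE.
by under [in X in _ -> X]eq_bigr => i _ do rewrite -[nat_of_ord j]/(nat_of_ord (Ordinal jn)) entryE.
Qed.

(** Some cofactor along the last row is nonzero by [exists_cofactor_neq0], which uses a large [f].
    The determinant is affine in the matching entry with that slope, so one value at most makes it
    vanish. *)
Lemma card_det0 r : (r < k)%N ->
  (#|[pred M | `[< (exists f, large_irreducible f) /\ corner_full_rank r M /\
       \det (upper_left r.+1 r.+1 (entry M)) = 0%R >]]| * #|X| <=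
     #|{: 'M[X]_(k, n)}|)%N.
Proof.
move=> rk; have rn : (r < n)%N by apply: ltn_trans lt_kn.
pose cof M j := cofactor (upper_left r.+1 r.+1 (entry M)) ord_max j.
pose pj M := odflt ord_max [pick j | cof M j != 0].
pose pos M := (Ordinal rk, widen_ord rn (pj M)).
(* These cofactors ignore row [r], so changing an entry of that row does not change the chosen
   position. *)
have cofE M x j l : cof (mx_update M (Ordinal rk, l) x) j = cof M j.
  apply: eq_cofactor_upper_left => i c ir; apply: entry_update.
  by rewrite xpair_eqE negb_and /= (ltn_eqF ir).
have posE M x : pos (mx_update M (pos M) x) = pos M.
  congr (_, widen_ord _ _); congr (odflt _ _); apply: eq_pick => j.
  by rewrite /pos cofE.
rewrite -[leqRHS]mul1n; apply: (card_determined_entry posE) => M.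
apply/card_le1_eqP => x y /asboolP[[f lf] [gx dx]] /asboolP[_ [gy dy]].
have [j0 cj0] := exists_cofactor_neq0 lf.1 (gx f lf).
have cMj0 : cof M j0 != 0 by rewrite -(cofE M x j0 (widen_ord rn (pj M))).
have cj : cof M (pj M) != 0.
  by rewrite /pj; case: pickP => [j //|/(_ j0)]; rewrite cMj0.
have dE z : \det (upper_left r.+1 r.+1 (entry (mx_update M (pos M) z))) =
    val_of z * cof M (pj M) + \sum_(j | j != pj M) entry M r j * cof M j.
  rewrite (expand_det_row _ ord_max) (bigD1 (pj M)) //=; congr (_ + _).
    rewrite -/(cof _ _) /pos cofE mxE; congr (_ * _).
    have /= ->
      := entryE (mx_update M (Ordinal rk, widen_ord rn (pj M)) z)
        (Ordinal rk) (widen_ord rn (pj M)).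
    by rewrite mxE eqxx.
  apply: eq_bigr => j jp; rewrite -/(cof _ _) /pos cofE mxE entry_update //=.
  by rewrite xpair_eqE negb_and eqxx /=.
apply: val_of_inj; apply: (mulIf cj).
by move: dx; rewrite -dy !dE => /addIr.
Qed.

(** The varying entry lies outside the square minor. Each bad value yields a large prime factor of
    this nonzero minor, and distinct values yield distinct primes, so at most [r + 1] values are
    bad. *)
Lemma card_det_neq0 r : (r < k)%N ->
  (#|[pred M | `[< [/\ corner_full_rank r M, ~ corner_full_rank r.+1 M &
       \det (upper_left r.+1 r.+1 (entry M)) != 0%R] >]]| * #|X| <=
     r.+1 * #|{: 'M[X]_(k, n)}|)%N.
Proof.
move=> rk; have rn : (r.+1 < n)%N by apply: leq_ltn_trans lt_kn.
pose p := (Ordinal rk, Ordinal rn).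
apply: (@card_determined_entry _ _ _ (fun=> p)) => // M.
set D := [pred x | _].
have exf x : exists f, x \in D -> large_irreducible f /\
    ~ full_rank_mod f (upper_left r.+1 r.+2 (entry (mx_update M p x))).
  have [xD|xD] := boolP (x \in D); last by exists (0 : {poly F}).
  move: xD => /asboolP[_ /existsNP[f /not_implyP[lf nf]] _].
  by exists f.
pose fx x := projT1 (cid (exf x)).
have fxP x : x \in D -> large_irreducible (fx x) /\
    ~ full_rank_mod (fx x) (upper_left r.+1 r.+2 (entry (mx_update M p x))).
  exact: (projT2 (cid (exf x))).
have upd i j x : (i, j) != (r, r.+1) -> entry (mx_update M p x) i j = entry M i j.
  by move=> ij; exact: (@entry_update M p x i j ij).
have ulE x : upper_left r.+1 r.+1 (entry (mx_update M p x)) =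
    upper_left r.+1 r.+1 (entry M).
  apply/matrixP => i j; rewrite !mxE upd // xpair_eqE negb_and.
  by rewrite (ltn_eqF (ltn_ord j)) orbT.
have entry_p x : entry (mx_update M p x) r r.+1 = val_of x.
  by have /= -> := entryE (mx_update M p x) (Ordinal rk) (Ordinal rn); rewrite mxE eqxx.
have fx_inj : {in D &, injective fx}.
  move=> x y xD yD fxy; have [lx nx] := fxP x xD; have [_ ny] := fxP y yD.
  rewrite -fxy in ny.
  have [gx _ _] := asboolP _ xD.
  have fd : fx x %| val_of x - val_of y.
    have := dvdp_entry_upper_left lx.1.2 _ (gx _ lx) nx ny.
    by rewrite !entry_p; apply => i j ij; rewrite !upd.
  apply: val_of_inj; apply/eqP; rewrite -subr_eq0; apply: contraTT fd => nz.
  apply/negP => /(dvdp_leq nz); apply/negP; rewrite -ltnNge.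
  apply: leq_ltn_trans (size_polyD _ _) _; rewrite size_polyN.
  by apply: leq_ltn_trans lx.2; rewrite geq_max !size_val.
have [/card0_eq D0|] := posnP #|D|; first by rewrite (fintype.eq_card0 D0).
move=> /card_gt0P[x0 x0D].
have [_ _ d0] := asboolP _ x0D; rewrite ulE in d0.
rewrite cardE -(size_map fx).
apply: (@count_large_irreducible_divisors F r.+1 s _ _ _ d0).
- by move=> i j; rewrite mxE; exact: size_entry.
- by rewrite map_inj_in_uniq ?enum_uniq // => x y; rewrite !mem_enum; exact: fx_inj.
- move=> f /mapP[x]; rewrite mem_enum => xD ->.
  have [[fi sf] nf] := fxP x xD; split=> //.
  by have := dvdp_det_upper_left fi.2 nf; rewrite ulE.
Qed.

Lemma card_corner_first_failure r : (r < k)%N ->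
  (#|[pred M | `[< (exists f, large_irreducible f) /\
      corner_full_rank r M /\ ~ corner_full_rank r.+1 M >]]| * #|X| <=
     k.+1 * #|{: 'M[X]_(k, n)}|)%N.
Proof.
(* One value for a vanishing minor plus [r + 1] for a nonzero one, and [r < k]. *)
move=> rk; apply: (@leq_trans (r.+2 * #|{: 'M[X]_(k, n)}|)); last first.
  by rewrite leq_mul2r ltnS rk orbT.
rewrite mulSn; apply: leq_trans (leq_add (card_det0 rk) (card_det_neq0 rk)).
rewrite -mulnDl leq_mul2r; apply/orP; right.
rewrite -cardUI; apply: leq_trans (leq_addr _ _); apply: subset_leq_card.
apply/fintype.subsetP => M /asboolP[exl [gM ngM]]; apply/orP.
have [d0|d0] := eqVneq (\det (upper_left r.+1 r.+1 (entry M))) 0.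
  by left; apply/asboolP.
by right; apply/asboolP.
Qed.

Lemma card_not_full_rank_large :
  (#|[pred M : 'M[X]_(k, n) | `[< exists2 f, large_irreducible f &
       ~ full_rank_mod f (map_mx val_of M) >]]| * #|X| <=
     k * k.+1 * #|{: 'M[X]_(k, n)}|)%N.
Proof.
pose B r := [pred M | `[< (exists f, large_irreducible f) /\
      corner_full_rank r M /\ ~ corner_full_rank r.+1 M >]].
have good0 M : corner_full_rank 0 M by move=> f _ v _ [].
have sub : (#|[pred M : 'M[X]_(k, n) | `[< exists2 f, large_irreducible f &
       ~ full_rank_mod f (map_mx val_of M) >]]| <= \sum_(r < k) #|B r|)%N.
  apply: (@leq_trans #|[pred M | [exists r : 'I_k, B r M]]|).
    apply: subset_leq_card; apply/fintype.subsetP => M /asboolP[f lf nf].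
    have ngk : ~ corner_full_rank k M by move=> /(full_rank_of_corner lf).
    apply: contrapT => /negP/existsPn nB.
    suff H r : (r <= k)%N -> corner_full_rank r M by apply: ngk; exact: H.
    elim: r => [//|r IH rk]; apply: contrapT => ngr.
    have /negP := nB (Ordinal rk); apply; apply/asboolP; split; first by exists f.
    by split=> //; apply: IH; exact: ltnW.
  rewrite -sum1_card; under [leqRHS]eq_bigr do rewrite -sum1_card.
  rewrite (exchange_big_dep predT) //= big_mkcond; apply: leq_sum => M _.
  case: ifP => // /existsP[r Br]; rewrite sum1_card; apply/card_gt0P.
  by exists r.
apply: (@leq_trans ((\sum_(r < k) #|B r|) * #|X|)); first by rewrite leq_mul2r sub orbT.
rewrite big_distrl -mulnA -[k in (k * _)%N]card_ord -sum_nat_const /=.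
by apply: leq_sum => r _; exact: card_corner_first_failure.
Qed.

End LargePrimes.

(** * Euler products *)

Section Irreducibles.

Variables (F : finFieldType).

Definition irreducibles (m : nat) : {fset {poly F}} :=
  fset_set [set f | monic_irreducible f /\ polydeg f = m].

(** An explicit list containing [irreducibles m]: it shows that [fset_set] is applied to a finite
    set there, and its length gives the bound [#|F| ^ m]. *)
Definition monic_polys (m : nat) : seq {poly F} :=
  map (fun p : {poly_m F} => 'X^m + (p : {poly F})) (enum {: {poly_m F}}).

Lemma irreducibles_sub m :
  [set f : {poly F} | monic_irreducible f /\ polydeg f = m] `<=`
  [set` [fset f in monic_polys m]%fset].
Proof.
move=> f [[mf [sf _]] df]; rewrite /= inE /=; apply/mapP.
have fm : f - 'X^m \is a poly_of_size m.
  rewrite qualifE /=; apply/leq_sizeP => i mi; rewrite coefB coefXn.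
  have sfm : size f = m.+1 by rewrite -df /polydeg prednK // ltnW.
  have [->|im] := eqVneq i m.
    by move: mf; rewrite monicE /lead_coef sfm /= => /eqP ->; rewrite subrr.
  by rewrite subr0 nth_default // sfm ltn_neqAle eq_sym im.
by exists (NPoly fm); rewrite ?mem_enum //= addrC subrK.
Qed.

Lemma irreducibles_finite m :
  finite_set [set f : {poly F} | monic_irreducible f /\ polydeg f = m].
Proof. exact: sub_finite_set (@irreducibles_sub m) (finite_fset _). Qed.

Lemma mem_irreducibles m f :
  f \in irreducibles m <-> monic_irreducible f /\ polydeg f = m.
Proof.
rewrite /irreducibles in_fset_set; last exact: irreducibles_finite.
by rewrite inE.
Qed.

Lemma num_monic_irreducible_le m : (num_monic_irreducible F m <= #|F| ^ m)%N.
Proof.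
rewrite -card_npoly cardE -(size_map (fun p : {poly_m F} => 'X^m + (p : {poly F}))).
apply: leq_trans (size_undup _); rewrite -card_fseq.
apply: fsubset_leq_card; apply/fsubsetP => f /mem_irreducibles fm.
exact: irreducibles_sub.
Qed.

(** Listed degree by degree, so that products over it split as in [degree_partial]; no irreducible
    has degree 0. *)
Fixpoint irreducibles_upto (M : nat) : seq {poly F} :=
  if M is M'.+1 then irreducibles_upto M' ++ enum_fset (irreducibles M'.+1) else [::].

Lemma mem_irreducibles_upto M f :
  f \in irreducibles_upto M <-> monic_irreducible f /\ (polydeg f <= M)%N.
Proof.
elim: M => [|M IH] /=.
  by split=> // -[[_ [sf _]]]; rewrite /polydeg; move: sf; set x := size f; lia.
rewrite mem_cat; split.
  case/orP => [/IH[fi fM]|/mem_irreducibles[fi ->]] //; split=> //; exact: leqW.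
move=> [fi]; rewrite leq_eqVlt => /orP[/eqP fM|fM]; apply/orP.
  by right; apply/mem_irreducibles.
by left; apply/IH.
Qed.

Lemma irreducibles_upto_uniq M : uniq (irreducibles_upto M).
Proof.
elim: M => //= M IH; rewrite cat_uniq IH fset_uniq andbT /=.
apply/hasPn => f /mem_irreducibles[_ fM]; apply/negP => /mem_irreducibles_upto[_].
by rewrite fM ltnn.
Qed.

Lemma big_irreducibles_upto (R : Type) (idx : R) (op : Monoid.law idx)
    (x : {poly F} -> R) M :
  \big[op/idx]_(f <- irreducibles_upto M) x f =
  \big[op/idx]_(1 <= m < M.+1) \big[op/idx]_(f <- irreducibles m) x f.
Proof.
elim: M => [|M IH]; first by rewrite /= big_nil big_geq.
by rewrite big_nat_recr //= -IH big_cat.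
Qed.

End Irreducibles.

Lemma ler_prod_sub (R : realDomainType) (T : eqType) (s t : seq T) (x : T -> R) :
  uniq t -> uniq s -> {subset s <= t} -> (forall f, f \in t -> 0 <= x f <= 1) ->
  \prod_(f <- t) x f <= \prod_(f <- s) x f.
Proof.
move=> ut us st x01; rewrite (bigID [in s]) /=.
have -> : \prod_(f <- t | f \in s) x f = \prod_(f <- s) x f.
  rewrite -big_filter; apply: perm_big; apply: uniq_perm; rewrite ?filter_uniq //.
  by move=> f; rewrite mem_filter andb_idr //; exact: st.
rewrite ler_piMr //.
  by rewrite big_seq; apply: prodr_ge0 => f /st/x01/andP[].
by rewrite big_seq_cond; apply: prodr_ile1 => f /andP[/x01].
Qed.

#[local] Existing Instance totally_filter.

Section EulerProduct.

Variables (R : realType) (F : finFieldType).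

Lemma card_finField_ge2 : 2 <= #|F|%:R :> R.
Proof. by rewrite ler_nat card_finNzRing_gt1. Qed.

Lemma expf_card_ge1 m : 1 <= #|F|%:R ^+ m :> R.
Proof. by rewrite exprn_ege1 // (le_trans _ card_finField_ge2) // ler1n. Qed.

Lemma prod_euler_factor_upto j M :
  \prod_(f <- irreducibles_upto F M) euler_factor R f j = @degree_partial R F j M.
Proof.
rewrite big_irreducibles_upto; apply: eq_big_nat => m _.
rewrite /num_monic_irreducible -/(irreducibles F m).
transitivity (\prod_(f <- irreducibles F m) (1 - (#|F|%:R ^+ (j * m))^-1 : R)).
  rewrite big_seq [RHS]big_seq; apply: eq_bigr => f /mem_irreducibles[_ <-].
  by [].
by rewrite big_const_seq count_predT -Monoid.iteropE.
Qed.

Lemma euler_factor_bounds (f : {poly F}) j : (0 < j)%N ->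
  monic_irreducible f -> 0 < euler_factor R f j <= 1.
Proof.
move=> j0 [_ [sf _]]; rewrite /euler_factor subr_gt0 gerBl invr_ge0.
rewrite (le_trans ler01 (expf_card_ge1 _)) andbT invf_lt1.
  rewrite exprn_egt1 ?(lt_le_trans _ card_finField_ge2) ?ltr1n // -lt0n.
  by rewrite muln_gt0 j0 /polydeg; move: sf; set x := size f; lia.
by rewrite (lt_le_trans ltr01 (expf_card_ge1 _)).
Qed.

Variable j : nat.
Hypothesis j2 : (2 <= j)%N.

(** There are at most [q ^ m] factors, so the product is at least [1 - q ^ (m - j * m)]; then
    [j >= 2] and [q >= 2]. *)
Lemma degree_factor_ge m : (0 < m)%N -> (1 - 2^-1 ^+ m : R) <=
  (1 - (#|F|%:R ^+ (j * m))^-1) ^+ num_monic_irreducible F m <= (1 : R).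
Proof.
move=> m0; set c := num_monic_irreducible F m; set x := (_ ^+ (j * m))^-1.
have q0 i : 0 < #|F|%:R ^+ i :> R := lt_le_trans ltr01 (expf_card_ge1 i).
have x01 : 0 <= x <= 1 by rewrite invr_ge0 ltW //= invf_le1 // expf_card_ge1.
have /andP[x0 x1] := x01.
rewrite exprn_ile1 ?subr_ge0 ?gerBl // andbT.
rewrite -[c]subn0 -prodr_const_nat.
apply: le_trans (prod_1B_ge _ (fun=> x01)).
rewrite sumr_const_nat subn0 lerD2l lerN2.
apply: (@le_trans _ _ (#|F|%:R ^+ m * x)).
  by rewrite -[leLHS]mulr_natl ler_wpM2r // -natrX ler_nat num_monic_irreducible_le.
have -> : #|F|%:R ^+ m * x = (#|F|%:R ^+ (j.-1 * m))^-1.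
  rewrite /x -{1}(prednK (ltnW j2)) mulSn exprD invfM mulrA mulfV ?mul1r //.
  by rewrite gt_eqF.
rewrite exprVn lef_pV2 ?posrE ?q0 ?exprn_gt0 //.
apply: (@le_trans _ _ (#|F|%:R ^+ m)).
  by rewrite lerXn2r ?nnegrE // card_finField_ge2.
rewrite ler_weXn2l ?(le_trans _ card_finField_ge2) ?ler1n //.
by rewrite leq_pmull // -ltnS prednK // ltnW.
Qed.

Lemma degree_partial_ge M : 4^-1 <= @degree_partial R F j M.
Proof.
case: M => [|M]; first by rewrite /degree_partial big_geq // invf_le1 // ler1n.
(* A constant bound alone would not survive multiplication by [1 - u]. With
   [u = 2 ^ (- M - 2) <= 1 / 4], one has [(1 / 4 + u) * (1 - u) >= 1 / 4 + u / 2]. *)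
suff : 4^-1 + 2^-1 ^+ M.+2 <= @degree_partial R F j M.+1.
  by apply: le_trans; rewrite lerDl exprn_ge0 // invr_ge0.
elim: M => [|M IH].
  rewrite /degree_partial big_nat1; have /andP[] := @degree_factor_ge 1 isT.
  by move=> h _; apply: le_trans h; rewrite expr1 expr2; lra.
rewrite /degree_partial big_nat_recr //= -/(@degree_partial R F j M.+1).
have /andP[h _] := @degree_factor_ge M.+2 isT.
have u0 : 0 <= 2^-1 ^+ M.+2 :> R by rewrite exprn_ge0 // invr_ge0.
have u4 : 2^-1 ^+ M.+2 <= 4^-1 :> R.
  have -> : 4^-1 = 2^-1 ^+ 2 :> R by rewrite exprVn -natrX.
  by rewrite ler_wiXn2l // ?invr_ge0 // invf_le1 // ler1n.
rewrite [2^-1 ^+ M.+3]exprS; move: IH h u0 u4.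
set u := 2^-1 ^+ M.+2; set P := @degree_partial R F j M.+1.
set c := _ ^+ num_monic_irreducible F _ => IH h u0 u4.
apply: (@le_trans _ _ ((4^-1 + u) * (1 - u))); first by nra.
by apply: ler_pM => //; nra.
Qed.

Lemma degree_partial_nonincr : {homo @degree_partial R F j : M M' / (M <= M')%N >-> M' <= M}.
Proof.
apply/nonincreasing_seqP => M; rewrite {1}/degree_partial big_nat_recr //=.
rewrite -/(@degree_partial R F j M) ler_piMr //.
  by apply: le_trans (degree_partial_ge M); rewrite invr_ge0.
by have /andP[] := @degree_factor_ge M.+1 isT.
Qed.

Lemma degree_partial_cvg :
  @degree_partial R F j M @[M --> \oo] --> degree_product R F j.
Proof.
apply: nonincreasing_is_cvgn; first exact: degree_partial_nonincr.
by exists 4^-1 => _ [M _ <-]; exact: degree_partial_ge.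
Qed.

Lemma degree_product_le M : degree_product R F j <= @degree_partial R F j M.
Proof. exact: nonincreasing_cvgn_ge degree_partial_nonincr degree_partial_cvg M. Qed.

Lemma degree_product_gt0 : 0 < degree_product R F j.
Proof.
apply: (@lt_le_trans _ _ 4^-1); first by rewrite invr_gt0.
apply: limr_ge degree_partial_cvg _; near=> M; exact: degree_partial_ge.
Unshelve. all: by end_near.
Qed.

(** All factors lie between 0 and 1, so enlarging the index set lowers the product. Once [J]
    contains all irreducibles of degree at most [M], its product lies between the limit and
    [degree_partial] at [M]. *)
Lemma euler_partial_cvg : @euler_partial R F j @ totally --> degree_product R F j.
Proof.
have ef01 (f : {poly F}) : monic_irreducible f -> 0 <= euler_factor R f j <= 1.
  by move=> fi; have /andP[/ltW -> ->] := euler_factor_bounds (ltnW j2) fi.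
have epE (J : {fset {poly F}}) : @euler_partial R F j J =
    \prod_(f <- [seq f <- J | f \in @monic_irreducible F]) euler_factor R f j.
  by rewrite big_filter.
have mem_J (J : {fset {poly F}}) (f : {poly F}) :
    f \in [seq f <- J | f \in @monic_irreducible F] <->
    monic_irreducible f /\ f \in J.
  by rewrite mem_filter; split=> [/andP[/set_mem]|[fi ->]] //; rewrite mem_set.
apply/cvgrPdist_le => eps eps0.
have [M _ HM] := cvgr_dist_le _ _ degree_partial_cvg _ eps0.
exists [fset f in irreducibles_upto F M]%fset => // J /= /fsubsetP MJ.
have ge_L : degree_product R F j <= @euler_partial R F j J.
  apply: le_trans (degree_product_le (\max_(f <- J) polydeg f)) _.
  rewrite epE -prod_euler_factor_upto; apply: ler_prod_sub.
  - exact: irreducibles_upto_uniq.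
  - by rewrite filter_uniq // fset_uniq.
  - move=> f /mem_J[fi fJ]; apply/mem_irreducibles_upto; split=> //.
    by rewrite (big_rem f) //= leq_maxl.
  - by move=> f /mem_irreducibles_upto[fi _]; exact: ef01.
have le_M : @euler_partial R F j J <= @degree_partial R F j M.
  rewrite epE -prod_euler_factor_upto; apply: ler_prod_sub.
  - by rewrite filter_uniq // fset_uniq.
  - exact: irreducibles_upto_uniq.
  - move=> f fM; apply/mem_J; split; last by apply: MJ; rewrite inE.
    by have /mem_irreducibles_upto[] := fM.
  - by move=> f /mem_J[fi _]; exact: ef01.
rewrite distrC ger0_norm ?subr_ge0 //; apply: le_trans (HM M (leqnn M)).
by rewrite distrC ger0_norm ?subr_ge0 ?degree_product_le // lerD2r.
Qed.

Lemma zeta_partial_cvg : @zeta_partial R F j @ totally --> (degree_product R F j)^-1.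
Proof.
have -> : @zeta_partial R F j = (fun J => (@euler_partial R F j J)^-1).
  by apply/funext => J; rewrite /zeta_partial /euler_partial /partial_prod prodfV.
apply: cvgV; last exact: euler_partial_cvg.
by rewrite gt_eqF // degree_product_gt0.
Qed.

End EulerProduct.

Lemma sum_half_pow_le (R : realType) (T d : nat) :
  \sum_(1 <= m < d.+1 | (T < m)%N) 2^-1 ^+ m <= 2^-1 ^+ T :> R.
Proof.
have h0 m : 0 <= 2^-1 ^+ m :> R by rewrite exprn_ge0 // invr_ge0.
have zero d' : (d' <= T)%N -> \sum_(1 <= m < d'.+1 | (T < m)%N) 2^-1 ^+ m = 0 :> R.
  move=> dT; rewrite big_nat_cond big1 // => m /andP[/andP[_ md] Tm]; lia.
have [/zero ->//|/ltnW Td] := leqP d T.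
(* Adding the rest of the geometric series makes the bound inductive. *)
suff H : \sum_(1 <= m < d.+1 | (T < m)%N) 2^-1 ^+ m + 2^-1 ^+ d <= 2^-1 ^+ T :> R.
  by apply: le_trans H; rewrite lerDl.
elim: d Td => [|d IH] Td.
  by rewrite zero ?add0r //; move: Td; rewrite leqn0 => /eqP->.
have [dT|Td'] := ltnP d T.
  by rewrite (_ : d.+1 = T) ?zero ?add0r //; lia.
rewrite big_mkcond big_nat_recr //= -big_mkcond /= ltnS Td'.
apply: le_trans (IH Td'); rewrite -addrA lerD2l exprS.
by move: (2^-1 ^+ d) => u; lra.
Qed.

(** * Density of primitive matrices *)

Section Density.

Variables (R : realType) (F : finFieldType) (e : 'I_#|F| -> F).
Hypotheses (e_bij : bijective e).
Hypothesis (e0 : forall i : 'I_#|F|, nat_of_ord i = 0%N -> e i = 0).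
Variables (k n : nat).
Hypotheses (k_gt0 : (0 < k)%N) (lt_kn : (k < n)%N).

Definition full_rank_upto (T : nat) (A : 'M[{poly F}]_(k, n)) : Prop :=
  forall f, f \in irreducibles_upto F T -> full_rank_mod f A.

Lemma boxcard_full_rank_upto_cvg T : (0 < T)%N ->
  ((boxcard e (full_rank_upto T) N)%:R / (N.+1 ^ (k * n))%:R : R) @[N --> \oo] -->
  \prod_(n - k + 1 <= j < n.+1) @degree_partial R F j T.
Proof.
move=> T0.
(* Since [T > 0], the list contains 'X. *)
have sT0 : irreducibles_upto F T != [::].
  have : 'X - 0%:P \in irreducibles_upto F T.
    apply/mem_irreducibles_upto; rewrite /polydeg size_XsubC; split=> //.
    by split; [exact: monicXsubC | exact: irredp_XsubC].
  by case: (irreducibles_upto F T).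
have sTi f : f \in irreducibles_upto F T -> monic_irreducible f.
  by move=> /mem_irreducibles_upto[].
have [mP sP dP] := @mod_density_prod R F k n _ _ _ sT0 (irreducibles_upto_uniq F T) sTi
  (fun f fT => mod_density_full_rank R (sTi f fT) (ltnW lt_kn)).
under eq_bigr do rewrite -prod_euler_factor_upto.
by rewrite exchange_big /=; apply: boxcard_cvg dP.
Qed.

Lemma boxcard_large_le N d : (N < #|F| ^ d.+1)%N ->
  (boxcard e (fun A : 'M[{poly F}]_(k, n) =>
      exists2 f, large_irreducible d f & ~ full_rank_mod f A) N
    * N.+1 <= k * k.+1 * N.+1 ^ (k * n))%N.
Proof.
move=> Nd;
have := @card_not_full_rank_large F 'I_N.+1 (fun m => poly_of_nat e m) d _ _ k n lt_kn.
rewrite card_mx !card_ord; apply.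
  by move=> m m' /(poly_of_nat_inj e_bij e0) E; exact: val_inj.
by move=> m; apply: (size_poly_of_nat e0); apply: leq_trans (ltn_ord m) Nd.
Qed.

Lemma boxcard_tail_le N T :
  (boxcard e (fun A => full_rank_upto T A /\ ~ primitive_mx A) N)%:R <=
  ((k * 2 ^ (k * n))%:R * 2^-1 ^+ T + (k * k.+1)%:R / N.+1%:R)
    * (N.+1 ^ (k * n))%:R :> R.
Proof.
have q1 := card_finNzRing_gt1 F.
(* The threshold degree: [q ^ d <= N + 1 < q ^ (d + 1)]. Up to [d] the bound modulo a single [f]
   applies; beyond it, [f] is large for the entries of the box. *)
set d := trunc_log #|F| N.+1.
have /andP[dN Nd] := trunc_log_bounds q1 (ltn0Sn N).
rewrite -/d in dN Nd.
pose s := [seq f <- irreducibles_upto F d | (T < polydeg f)%N].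
pose B1 A := exists2 f, f \in s & ~ @full_rank_mod F f k n A.
pose B2 A := exists2 f, large_irreducible d f & ~ @full_rank_mod F f k n A.
have sub A : full_rank_upto T A /\ ~ primitive_mx A -> B1 A \/ B2 A.
  move=> [fT /existsNP[f /not_implyP[fi nf]]].
  have [fd|fd] := leqP (polydeg f) d; [left|right]; exists f => //.
    rewrite mem_filter ltnNge; apply/andP; split; last exact/mem_irreducibles_upto.
    by apply/negP => fT'; apply: nf; apply: fT; exact/mem_irreducibles_upto.
  by split=> //; move: fd; rewrite /polydeg; set x := size f; lia.
have le12 : (boxcard e (fun A => full_rank_upto T A /\ ~ primitive_mx A) N <=
    boxcard e B1 N + boxcard e B2 N)%N.
  exact: leq_trans (le_boxcard e N sub) (boxcardU _ _ _ _).
have N0 : 0 < N.+1%:R :> R by rewrite ltr0n.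
apply: (@le_trans _ _ ((boxcard e B1 N)%:R + (boxcard e B2 N)%:R)).
  by rewrite -natrD ler_nat.
rewrite mulrDl; apply: lerD; last first.
  rewrite mulrAC ler_pdivlMr // -!natrM ler_nat; apply: boxcard_large_le.
  exact: ltnW.
apply: (@le_trans _ _ (\sum_(f <- s) (boxcard e (fun A => ~ @full_rank_mod F f k n A) N)%:R : R)).
  have := boxcard_bigU e s (fun f A => ~ @full_rank_mod F f k n A) N.
  by rewrite -(ler_nat R) natr_sum.
apply: (@le_trans _ _ (\sum_(f <- s)
    (k * 2 ^ (k * n))%:R * #|F|%:R ^- (2 * polydeg f) * (N.+1 ^ (k * n))%:R)).
  rewrite [leLHS]big_seq [leRHS]big_seq; apply: ler_sum => f.
  rewrite mem_filter => /andP[_ /mem_irreducibles_upto[fi fd]].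
  apply: boxcard_not_full_rank_le => //; apply: leq_trans dN.
  by rewrite leq_exp2l.
(* In each degree [m] at most [q ^ m] terms [q ^ (- 2 m)] remain, of sum at most [2 ^ (- m)]. *)
rewrite -mulr_suml -mulr_sumr ler_wpM2r // ler_wpM2l //.
apply: le_trans (sum_half_pow_le R T d).
rewrite big_filter big_mkcond big_irreducibles_upto /= [leRHS]big_mkcond /=.
apply: ler_sum => m _; rewrite big_seq.
under eq_bigr => f /mem_irreducibles[_ ->] do [].
case: ifP => Tm; last by rewrite big1.
rewrite -big_seq big_const_seq count_predT -Monoid.iteropE /=.
rewrite -[leLHS]mulr_natl.
have q0 i : 0 < #|F|%:R ^+ i :> R := lt_le_trans ltr01 (expf_card_ge1 R F i).
apply: (@le_trans _ _ (#|F|%:R ^+ m * #|F|%:R ^- (2 * m))).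
  by rewrite ler_wpM2r // -natrX ler_nat num_monic_irreducible_le.
rewrite mul2n -addnn exprD invfM mulrA mulfV ?gt_eqF // mul1r.
by rewrite exprVn lef_pV2 ?posrE ?q0 ?exprn_gt0 // lerXn2r ?nnegrE // card_finField_ge2.
Qed.

Lemma prod_cvg (I : Type) (s : seq I) (u : I -> R ^nat) (l : I -> R) (P : pred I) :
  (forall i, P i -> u i x @[x --> \oo] --> l i) ->
  (\prod_(i <- s | P i) u i x) @[x --> \oo] --> \prod_(i <- s | P i) l i.
Proof.
move=> ul; elim: s => [|i s IH].
  rewrite big_nil; under eq_fun do rewrite big_nil; exact: cvg_cst.
rewrite big_cons; under eq_fun do rewrite big_cons.
by case: ifP => // Pi; apply: cvgM => //; exact: ul.
Qed.

Lemma primitive_mx_density :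
  ((boxcard e (@primitive_mx F k n) N)%:R / (N.+1 ^ (k * n))%:R : R) @[N --> \oo] -->
  \prod_(n - k + 1 <= j < n.+1) degree_product R F j.
Proof.
set L := \prod_(_ <= j < _) _.
have LT : \prod_(n - k + 1 <= j < n.+1) @degree_partial R F j T @[T --> \oo] --> L.
  rewrite /L big_nat_cond; under eq_fun do rewrite big_nat_cond.
  apply: prod_cvg => j /andP[/andP[j2 _] _]; apply: degree_partial_cvg; lia.
have C0 : (k * 2 ^ (k * n))%:R * 2^-1 ^+ T @[T --> \oo] --> (0 : R).
  rewrite -[X in _ --> X](mulr0 (k * 2 ^ (k * n))%:R); apply: cvgM; first exact: cvg_cst.
  by apply: cvg_expr; rewrite ger0_norm ?invr_ge0 // invf_lt1 // ltr1n.
have D0 : (k * k.+1)%:R / N.+1%:R @[N --> \oo] --> (0 : R).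
  rewrite -[X in _ --> X](mulr0 (k * k.+1)%:R); apply: cvgM; first exact: cvg_cst.
  exact: cvg_harmonic.
apply/cvgrPdist_le => eps eps0.
have eps4 : 0 < eps / 4 by rewrite divr_gt0.
(* [T] is fixed before [N]. The four quarters of [eps] are the truncation of the Euler product, the
   convergence for this [T], and the two terms of [boxcard_tail_le]. *)
have [T [T0 LTe CTe]] : exists T, [/\ (0 < T)%N,
    `|L - \prod_(n - k + 1 <= j < n.+1) @degree_partial R F j T| <= eps / 4 &
    (k * 2 ^ (k * n))%:R * 2^-1 ^+ T <= eps / 4].
  have [T1 _ H1] := cvgr_dist_le _ _ LT _ eps4; have [T2 _ H2] := cvgr_dist_le _ _ C0 _ eps4.
  exists (maxn 1 (maxn T1 T2)); split; first by rewrite leq_maxl.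
    by apply: H1; rewrite /= !leq_max leqnn orbT.
  have := H2 (maxn 1 (maxn T1 T2)); rewrite sub0r normrN => H.
  by apply: le_trans (ler_norm _) (H _); rewrite /= !leq_max leqnn !orbT.
near=> N.
have bN : 0 < (N.+1 ^ (k * n))%:R :> R by rewrite ltr0n expn_gt0.
pose r (S : 'M[{poly F}]_(k, n) -> Prop) := (boxcard e S N)%:R / (N.+1 ^ (k * n))%:R : R.
have h1 : `|\prod_(n - k + 1 <= j < n.+1) @degree_partial R F j T
    - r (full_rank_upto T)| <= eps / 4.
  by rewrite /r; near: N; exact: cvgr_dist_le _ _ (boxcard_full_rank_upto_cvg T0) _ eps4.
have h2 : (k * k.+1)%:R / N.+1%:R <= eps / 4 :> R.
  have : `|0 - (k * k.+1)%:R / N.+1%:R| <= eps / 4 :> R.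
    by near: N; exact: cvgr_dist_le _ _ D0 _ eps4.
  by rewrite sub0r normrN; exact: le_trans (ler_norm _).
have h3 : r (@primitive_mx F k n) <= r (full_rank_upto T).
  rewrite ler_pM2r ?invr_gt0 // ler_nat; apply: le_boxcard => A pA f.
  by move=> /mem_irreducibles_upto[fi _]; exact: pA.
have h4 : r (full_rank_upto T) <= r (@primitive_mx F k n) + (eps / 4 + eps / 4).
  apply: (@le_trans _ _ (r (@primitive_mx F k n) +
     r (fun A => full_rank_upto T A /\ ~ primitive_mx A))).
    rewrite -mulrDl ler_pM2r ?invr_gt0 // -natrD ler_nat.
    apply: leq_trans (boxcardU _ _ _ _); apply: le_boxcard => A fA.
    by have [pA|pA] := pselect (primitive_mx A); [left|right].
  rewrite lerD2l ler_pdivrMr //; apply: le_trans (boxcard_tail_le N T) _.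
  by rewrite ler_pM2r // lerD.
rewrite -/(r _); move: h1 LTe h3 h4; rewrite !ler_norml.
by move=> /andP[? ?] /andP[? ?] ? ?; apply/andP; split; lra.
Unshelve. all: by end_near.
Qed.

End Density.

Theorem theorem1 (R : realType) (F : finFieldType)
    (e : 'I_#|F| -> F) (e_bij : bijective e)
    (e0 : forall i : 'I_#|F|, nat_of_ord i = 0%N -> e i = 0)
    (k n : nat) (k_gt0 : (0 < k)%N) (lt_kn : (k < n)%N) :
  [/\ forall j : nat, (n - k + 1 <= j <= n)%N ->
        [/\ cvg (@euler_partial R F j @ totally),
            cvg (@degree_partial R F j @ \oo) &
            cvg (@zeta_partial R F j @ totally)],
      has_natural_density e (@unimodular F k n (ltnW lt_kn))
        (\prod_(n - k + 1 <= j < n.+1) euler_product R F j),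
      \prod_(n - k + 1 <= j < n.+1) euler_product R F j
        = \prod_(n - k + 1 <= j < n.+1) degree_product R F j &
      \prod_(n - k + 1 <= j < n.+1) degree_product R F j
        = \prod_(n - k + 1 <= j < n.+1) (zetaq R F j)^-1].
Proof.
(* Here [k < n] keeps the exponents in the range where the products are shown to converge. *)
have j2 j : (n - k + 1 <= j)%N -> (2 <= j)%N by lia.
have EP : \prod_(n - k + 1 <= j < n.+1) euler_product R F j =
    \prod_(n - k + 1 <= j < n.+1) degree_product R F j.
  apply: eq_big_nat => j /andP[/j2 hj _].
  exact (cvg_lim (F := totally) (FF := totally_filter) (@Rhausdorff R)
    (@euler_partial_cvg R F j hj)).
split=> //.
- move=> j /andP[/j2 hj _]; split.
  + by apply/cvg_ex; exists (degree_product R F j); exact: euler_partial_cvg.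
  + exact: degree_partial_cvg.
  + by apply/cvg_ex; exists (degree_product R F j)^-1; exact: zeta_partial_cvg.
- rewrite EP /has_natural_density.
  have -> : @unimodular F k n (ltnW lt_kn) = [set A | primitive_mx A].
    by apply/funext => A; apply/propext; exact: unimodularP.
  under eq_fun do rewrite (box_ratioE e_bij e0).
  exact: primitive_mx_density.
- apply: eq_big_nat => j /andP[/j2 hj _].
  by rewrite /zetaq (cvg_lim (F := totally) (FF := totally_filter) (@Rhausdorff R)
    (@zeta_partial_cvg R F j hj)) ?invrK.
Qed.
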